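(* Let $n\ge 1$ be an integer, let $m$ be an integer with $0\le m<n$, and let $x$ be a nonzero real number. Then $$\left.\frac{\partial \mathrm{Ei}_{\alpha,\beta}(x)}{\partial\alpha}\right|_{\alpha=n,\ \beta=-m}=-\frac{x^{(m+1)/n}}{n}\sum_{t=0}^{n-1}\exp\left(\frac{2\pi i\,t\,(m+1)}{n}\right)e^{\xi_t}\left[E_1(\xi_t)+\ln \xi_t\right],$$ where $\xi_t=\exp\left(\frac{2\pi i t}{n}\right)x^{1/n}$.
   Context: The integral Mittag-Leffler function is $\mathrm{Ei}_{\alpha,\beta}(x)=\sum_{k=1}^{\infty}\frac{x^k}{k\,\Gamma(\alpha k+\beta)}$ (with $1/\Gamma=0$ at the poles of $\Gamma$), so that $\frac{\partial \mathrm{Ei}_{\alpha,\beta}(x)}{\partial\alpha}=-\sum_{k=1}^\infty\frac{\psi(\alpha k+\beta)}{\Gamma(\alpha k+\beta)}x^k$, with $\psi=\Gamma'/\Gamma$ the digamma function. $E_1(z)=\int_z^\infty \frac{e^{-t}}{t}\,dt$ is the exponential integral and $\ln$ is the principal logarithm. The combination $E_1(z)+\ln z$ equals the entire function $\mathrm{Ein}(z)-\gamma$, where $\mathrm{Ein}(z)=\int_0^z\frac{1-e^{-t}}{t}\,dt$ and $\gamma$ is the Euler-Mascheroni constant; on the negative real axis $E_1$ and $\ln$ are taken on the same side of the cut, so that this identity persists. Powers are principal: $x^{1/n}$ is the principal $n$-th root and $x^{(m+1)/n}=(x^{1/n})^{m+1}$. *)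

(* Defs.v *)
From Stdlib Require Import Reals ZArith.
From Coquelicot Require Import Coquelicot.
Open Scope R_scope.

(** * Complex elementary functions *)

Definition Cexp (z : C) : C :=
  (exp (Re z) * cos (Im z), exp (Re z) * sin (Im z)).

(* Principal argument, with values in (-PI, PI]: on the negative real axis it
   is PI.  Its value at 0 is irrelevant. *)
Definition Carg (z : C) : R :=
  if Rle_dec 0 (Im z) then acos (Re z / Cmod z) else - acos (Re z / Cmod z).

Definition Cln (z : C) : C := (ln (Cmod z), Carg z).

Definition Croot (n : nat) (z : C) : C := Cexp (Cln z / RtoC (INR n))%C.

(** * The reciprocal Gamma function on the real line *)

(* Euler's integral: this is Gamma z for z > 0. *)
Definition GammaInt (z : R) : R :=
  RInt_gen (fun t => Rpower t (z - 1) * exp (- t))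
    (at_right 0) (Rbar_locally p_infty).

(* z (z + 1) ... (z + N - 1) *)
Fixpoint rising (z : R) (N : nat) : R :=
  match N with
  | O => 1
  | S N' => rising z N' * (z + INR N')
  end.

(* 1 / Gamma z for every real z, where Gamma is extended from z > 0 by
   Gamma z = Gamma (z + N) / (z (z + 1) ... (z + N - 1)).  The N used here is
   the least natural number with z + N > 0 (so N = 0 if z > 0).  At the poles
   0, -1, -2, ... the product contains the factor 0, hence the value is 0. *)
Definition rGamma (z : R) : R :=
  let N := Z.to_nat (up (- z)) in rising z N / GammaInt (z + INR N).

(* The integral Mittag-Leffler function; the summation index is k = j + 1. *)
Definition EiML (alpha beta x : R) : R :=
  Series (fun j => let k := S j in
    x ^ k / INR k * rGamma (alpha * INR k + beta)).

(** * The exponential integral *)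

(* Integral of exp(-t)/t along the horizontal ray t = z + s, s >= 0.  The ray
   avoids the cut when z is not in (-oo, 0]. *)
Definition ExpIntE1_ray (z : C) : C :=
  RInt_gen (V := C_R_CompleteNormedModule)
    (fun s : R => Cexp (- (z + RtoC s)) / (z + RtoC s))%C
    (at_point 0) (Rbar_locally p_infty).

(* On the cut, ExpIntE1 is the limit from the upper half-plane, the side from which
   the principal logarithm Cln is continuous. *)
Definition ExpIntE1 (z : C) : C :=
  if Req_EM_T (Im z) 0 then
    if Rlt_dec (Re z) 0 then
      lim (T := C_R_CompleteNormedModule)
        (filtermap (fun eps : R => ExpIntE1_ray (z + RtoC eps * Ci)%C) (at_right 0))
    else ExpIntE1_ray z
  else ExpIntE1_ray z.

(* Main.v *)
Require Import Defs.
From Stdlib Require Import Reals ZArith Lra Lia Psatz.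
From Coquelicot Require Import Coquelicot.
Open Scope R_scope.

(** Write psi for the digamma function and F(z) for the entire function
    [sum_j psi(j+1) z^j / j!], the exponential generating function of the
    numbers psi(j+1).  Both sides of the theorem extract the same
    terms from the series of F.

    On the left, m < n makes every argument [alpha k - m] positive for alpha
    near n, and at alpha = n it is the integer j + 1 with j = n k - m - 1.  As
    [(1/Gamma)'(j+1) = - psi(j+1) / j!], termwise differentiation gives
    [- sum_k x^k psi(n k - m) / (n k - m - 1)!], which, up to sign, is r^(m+1),
    with r the n-th root of x, times the sum of those terms of F(r) whose
    exponent j satisfies j + m + 1 = 0 mod n.  The weighted mean over the
    n-th roots of unity on the right performs the same selection, once
    [e^z (E_1(z) + ln z) = F(z)] is known for z <> 0 (lemma
    [Cexp_mult_E1_plus_ln]).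

    That identity is proved without contour integrals.  The function
    P(z) = e^(-z) F(z) satisfies P'(z) = (1 - e^(-z)) / z, because
    psi(j+2) = psi(j+1) + 1/(j+1).  Hence Ln - P is a primitive of
    e^(-z) / z along each horizontal ray that avoids the cut, and the integral
    defining E_1 equals P(z) - Ln z as soon as Ln - P tends to 0 at the end of
    the ray.  For real s > 0, P(s) is the mean of psi(J+1) for a Poisson
    variable J of parameter s, so Jensen's inequality and
    ln y - 1/y <= psi(y) <= ln y squeeze P(s) between ln s - 1/s and
    ln (s+1) (lemma [Ein_minus_gamma_real_bounds]); moving vertically off the
    real axis costs O(1/s).  On the cut both E_1 and Ln are limits from
    above.  The Euler constant enters only through psi(1) = - gamma and never
    has to be named.

    The facts on psi come from the Bohr-Mollerup circle of ideas rather than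
    from differentiation under the integral: ln Gamma is convex (Young's
    inequality) and ln Gamma(y+1) = ln Gamma(y) + ln y, so its difference
    quotients at y are squeezed between bounds that merge as y grows, and the
    functional equation transports differentiability back to every y > 0.

    Termwise differentiation, for the series in alpha as well as for F, rests
    on [is_derive_series]: a summable common Lipschitz bound suffices. *)

(** * Convexity inequalities for exp and ln *)

Lemma ln_le_tangent (x c : R) : 0 < x -> 0 < c -> ln x <= ln c + (x - c) / c.
Proof.
  intros Hx Hc.
  assert (H : ln (x / c) <= x / c - 1).
  { assert (Hq : 0 < x / c) by (apply Rdiv_lt_0_compat; assumption).
    pose proof (exp_ineq1_le (ln (x / c))) as H. rewrite exp_ln in H by exact Hq. lra. }
  rewrite ln_div in H by assumption.
  replace ((x - c) / c) with (x / c - 1) by (field; lra). lra.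
Qed.

(** Average the tangent-line inequalities at the barycentre of a and b. *)
Lemma exp_convex (a b l : R) : 0 <= l <= 1 ->
  exp (l * a + (1 - l) * b) <= l * exp a + (1 - l) * exp b.
Proof.
  intro Hl. set (c := l * a + (1 - l) * b).
  assert (Ht : forall x, exp c * (1 + (x - c)) <= exp x).
  { intro x. replace (exp x) with (exp c * exp (x - c))
      by (rewrite <- exp_plus; f_equal; ring).
    apply Rmult_le_compat_l; [left; apply exp_pos | apply exp_ineq1_le]. }
  assert (H1 : l * (exp c * (1 + (a - c))) <= l * exp a)
    by (apply Rmult_le_compat_l; [lra | apply Ht]).
  assert (H2 : (1 - l) * (exp c * (1 + (b - c))) <= (1 - l) * exp b)
    by (apply Rmult_le_compat_l; [lra | apply Ht]).
  replace (exp c) with (l * (exp c * (1 + (a - c))) + (1 - l) * (exp c * (1 + (b - c))))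
    by (unfold c; ring).
  lra.
Qed.

(** * Improper integrals *)

Lemma ex_RInt_pos (f : R -> R) (a b : R) :
  (forall t, 0 < t -> continuous f t) -> 0 < a -> 0 < b -> ex_RInt f a b.
Proof.
  intros Hc Ha Hb. apply (ex_RInt_continuous (V := R_CompleteNormedModule)).
  intros t Ht. apply Hc.
  apply Rlt_le_trans with (2 := proj1 Ht). apply Rmin_glb_lt; assumption.
Qed.

(** For a nonnegative integrand the integrals over compact intervals increase with
    the interval, so boundedness alone gives convergence of the improper
    integral; the last two clauses say that the value is the supremum, which
    reduces inequalities between improper integrals to compact intervals. *)
Lemma is_RInt_gen_sup (f : R -> R) (M : R) :
  (forall t, 0 < t -> continuous f t) ->
  (forall t, 0 < t -> 0 <= f t) ->
  (forall a b, 0 < a <= b -> RInt f a b <= M) ->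
  exists L, is_RInt_gen f (at_right 0) (Rbar_locally p_infty) L
    /\ (forall a b, 0 < a <= b -> RInt f a b <= L)
    /\ (forall K, (forall a b, 0 < a <= b -> RInt f a b <= K) -> L <= K).
Proof.
  intros Hc Hp HM.
  destruct (completeness (fun y => exists a b, 0 < a <= b /\ y = RInt f a b))
    as [L [HL1 HL2]].
  - exists M. intros y (a & b & Hab & ->). now apply HM.
  - exists (RInt f 1 1), 1, 1. split; [lra | reflexivity].
  - assert (Hle : forall a b, 0 < a <= b -> RInt f a b <= L).
    { intros a b Hab. apply HL1. now exists a, b. }
    exists L. split; [| split].
    + intros P [eps HP].
      assert (Hex : exists a b, 0 < a <= b /\ L - eps < RInt f a b).
      { destruct (Classical_Prop.classic
          (exists a b, 0 < a <= b /\ L - eps < RInt f a b)) as [H | H]; [exact H |].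
        exfalso.
        assert (L <= L - eps).
        { apply HL2. intros y (a & b & Hab & ->).
          apply Rnot_lt_le. intro Hlt. apply H. now exists a, b. }
        pose proof (cond_pos eps). lra. }
      destruct Hex as (a0 & b0 & Hab0 & Hlt).
      unfold filtermapi.
      apply (Filter_prod _ _ _ (fun a => 0 < a < a0) (fun b => b0 < b)).
      * exists (mkposreal a0 (proj1 Hab0)). intros y Hy Hy0. split; [exact Hy0 |].
        change (Rabs (y - 0) < a0) in Hy. rewrite Rminus_0_r in Hy.
        apply Rle_lt_trans with (2 := Hy). apply Rle_abs.
      * now exists b0.
      * intros a b Ha Hb. simpl. exists (RInt f a b). split.
        -- apply (RInt_correct (V := R_CompleteNormedModule) f a b). apply ex_RInt_pos; [exact Hc | lra | lra].
        -- apply HP. change (Rabs (RInt f a b - L) < eps).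
           assert (H1 : RInt f a b <= L) by (apply Hle; lra).
           assert (H2 : RInt f a0 b0 <= RInt f a b).
           { assert (E1 : RInt f a a0 + RInt f a0 b0 = RInt f a b0).
             { apply (RInt_Chasles f a a0 b0); apply ex_RInt_pos; try assumption; lra. }
             assert (E2 : RInt f a b0 + RInt f b0 b = RInt f a b).
             { apply (RInt_Chasles f a b0 b); apply ex_RInt_pos; try assumption; lra. }
             assert (0 <= RInt f a a0).
             { apply RInt_ge_0; [lra | apply ex_RInt_pos; try assumption; lra |].
               intros t Ht. apply Hp. lra. }
             assert (0 <= RInt f b0 b).
             { apply RInt_ge_0; [lra | apply ex_RInt_pos; try assumption; lra |].
               intros t Ht. apply Hp. lra. }
             lra. }
           pose proof (cond_pos eps). apply Rabs_def1; lra.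
    + exact Hle.
    + intros K HK. apply HL2. intros y (a & b & Hab & ->). now apply HK.
Qed.

(** Serves both the Gamma integral and the complex-valued integrals along the
    rays of E_1, hence the values in an arbitrary normed module. *)
Lemma is_RInt_gen_antiderivative {V : NormedModule R_AbsRing}
  (Fa Fb : (R -> Prop) -> Prop) (FFa : Filter Fa) (FFb : Filter Fb)
  (f F : R -> V) (la lb : V) :
  filter_prod Fa Fb (fun ab =>
    is_RInt f (fst ab) (snd ab) (minus (F (snd ab)) (F (fst ab)))) ->
  filterlim F Fa (locally la) -> filterlim F Fb (locally lb) ->
  is_RInt_gen f Fa Fb (minus lb la).
Proof.
  intros HI Ha Hb P HP.
  assert (Hl : filterlim (fun ab : R * R => minus (F (snd ab)) (F (fst ab)))
    (filter_prod Fa Fb) (locally (minus lb la))).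
  { apply (filterlim_comp_2 (G := locally lb) (H := locally (opp la))
      (fun ab => F (snd ab)) (fun ab => opp (F (fst ab))) plus).
    - exact (filterlim_comp _ _ _ snd F _ Fb _ filterlim_snd Hb).
    - refine (filterlim_comp _ _ _ (fun ab => F (fst ab)) opp _ (locally la) _ _
        (filterlim_opp la)).
      exact (filterlim_comp _ _ _ fst F _ Fa _ filterlim_fst Ha).
    - apply (filterlim_plus lb (opp la)). }
  specialize (Hl P HP). unfold filtermap in Hl.
  unfold filtermapi.
  apply (filter_imp (F := filter_prod Fa Fb)) with (2 := filter_and (F := filter_prod Fa Fb) _ _ HI Hl).
  intros ab [H1 H2]. exists (minus (F (snd ab)) (F (fst ab))). split; assumption.
Qed.

(** * The Gamma integral *)

Definition gamma_integrand (z t : R) : R := Rpower t (z - 1) * exp (- t).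

Lemma gamma_integrand_pos (z t : R) : 0 < gamma_integrand z t.
Proof. apply Rmult_lt_0_compat; apply exp_pos. Qed.

Lemma gamma_integrand_continuous (z t : R) :
  0 < t -> continuous (gamma_integrand z) t.
Proof.
  intro Ht. apply (ex_derive_continuous (V := R_NormedModule)).
  unfold gamma_integrand, Rpower. auto_derive. exact Ht.
Qed.

(** A single primitive dominates the integrand at both ends: up to a constant the
    majorant is the derivative of [(t / (1 + t)) ^ z], which is increasing and
    bounded by 1. *)
Lemma gamma_integrand_le (z : R) : 0 < z -> exists c, 0 < c /\
  forall a b, 0 < a <= b -> RInt (gamma_integrand z) a b <= c.
Proof.
  intro Hz.
  (* K bounds (1 + t)^(z+1) e^(-t), by the tangent to ln at z + 1. *)
  set (K := exp (1 + (z + 1) * (ln (z + 1) - 1))).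
  set (H := fun t : R => K / z * exp (z * (ln t - ln (1 + t)))).
  assert (HK : 0 < K) by apply exp_pos.
  assert (HKz : 0 < K / z) by (apply Rdiv_lt_0_compat; assumption).
  exists (K / z). split; [exact HKz |].
  intros a b Hab.
  set (h := fun t : R => K * (exp (z * (ln t - ln (1 + t))) * (1 / (t * (1 + t))))).
  assert (HI : is_RInt h a b (H b - H a)).
  { apply (is_RInt_derive (V := R_CompleteNormedModule) H h).
    - intros t Ht. rewrite Rmin_left in Ht by lra. unfold H, h.
      auto_derive; [lra |].
      unfold Rminus. field; repeat split; lra.
    - intros t Ht. rewrite Rmin_left in Ht by lra.
      apply (ex_derive_continuous (V := R_NormedModule)). unfold h.
      auto_derive. repeat split; try lra. apply Rmult_integral_contrapositive; lra. }
  apply Rle_trans with (H b - H a).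
  - rewrite <- (is_RInt_unique _ _ _ _ HI).
    apply RInt_le; [lra | | now exists (H b - H a) |].
    + apply ex_RInt_pos; [apply gamma_integrand_continuous | lra | lra].
    + intros t Ht. unfold gamma_integrand, h, K, Rpower.
      replace (1 / (t * (1 + t))) with (exp (- ln t - ln (1 + t))).
      * rewrite <- !exp_plus.
        assert (Hx : (z - 1) * ln t + - t <=
          1 + (z + 1) * (ln (z + 1) - 1) +
          (z * (ln t - ln (1 + t)) + (- ln t - ln (1 + t)))).
        { assert (Hl := ln_le_tangent (1 + t) (z + 1) ltac:(lra) ltac:(lra)).
          assert (Hm : (z + 1) * ln (1 + t) <=
            (z + 1) * (ln (z + 1) + (1 + t - (z + 1)) / (z + 1))).
          { apply Rmult_le_compat_l; lra. }
          replace ((z + 1) * (ln (z + 1) + (1 + t - (z + 1)) / (z + 1)))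
            with ((z + 1) * ln (z + 1) + (1 + t - (z + 1))) in Hm by (field; lra).
          lra. }
        destruct Hx as [Hx | Hx]; [left; now apply exp_increasing | right; now rewrite Hx].
      * unfold Rminus. rewrite exp_plus, !exp_Ropp, !exp_ln by lra. field; repeat split; lra.
  - assert (H b <= K / z * 1).
    { apply Rmult_le_compat_l; [lra |].
      assert (Hl : ln b < ln (1 + b)) by (apply ln_increasing; lra).
      left. rewrite <- exp_0 at 2. apply exp_increasing. nra. }
    assert (0 < H a) by (apply Rmult_lt_0_compat; [assumption | apply exp_pos]).
    lra.
Qed.

Lemma GammaInt_sup (z : R) : 0 < z ->
  is_RInt_gen (gamma_integrand z) (at_right 0) (Rbar_locally p_infty) (GammaInt z)
  /\ (forall a b, 0 < a <= b -> RInt (gamma_integrand z) a b <= GammaInt z)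
  /\ (forall K, (forall a b, 0 < a <= b -> RInt (gamma_integrand z) a b <= K) ->
      GammaInt z <= K).
Proof.
  intro Hz. destruct (gamma_integrand_le z Hz) as (c & Hc & Hle).
  destruct (is_RInt_gen_sup (gamma_integrand z) c) as (L & H1 & H2 & H3).
  - apply gamma_integrand_continuous.
  - intros t _. left. apply gamma_integrand_pos.
  - exact Hle.
  - assert (E : GammaInt z = L)
      by exact (is_RInt_gen_unique (V := R_CompleteNormedModule) _ _ H1).
    rewrite E. auto.
Qed.

(** Keeping only the interval [L, L+1] of the integral; since L is free, this
    makes Gamma outgrow every geometric sequence. *)
Lemma GammaInt_ge (z L : R) : 0 < z -> 1 <= L ->
  Rpower L z * (exp (- (L + 1)) / (L + 1)) <= GammaInt z.
Proof.
  intros Hz HL. destruct (GammaInt_sup z Hz) as (_ & H2 & _).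
  apply Rle_trans with (RInt (gamma_integrand z) L (L + 1)); [| apply H2; lra].
  set (c := Rpower L z * (exp (- (L + 1)) / (L + 1))).
  replace c with (RInt (fun _ => c) L (L + 1)).
  - apply RInt_le; [lra | apply ex_RInt_const | |].
    + apply ex_RInt_pos; [apply gamma_integrand_continuous | lra | lra].
    + intros t Ht. unfold c, gamma_integrand, Rpower.
      replace (exp ((z - 1) * ln t)) with (exp (z * ln t) * / t).
      * assert (H : exp (z * ln L) <= exp (z * ln t)).
        { left. apply exp_increasing. apply Rmult_lt_compat_l; [lra |].
          apply ln_increasing; lra. }
        assert (H' : exp (- (L + 1)) <= exp (- t)).
        { left. apply exp_increasing. lra. }
        assert (H3 : / (L + 1) <= / t) by (apply Rinv_le_contravar; lra).
        pose proof (exp_pos (z * ln L)). pose proof (exp_pos (- (L + 1))).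
        assert (0 < / (L + 1)) by (apply Rinv_0_lt_compat; lra).
        unfold Rdiv. rewrite (Rmult_assoc (exp (z * ln t))).
        apply Rmult_le_compat; [lra | apply Rmult_le_pos; lra | exact H |].
        rewrite (Rmult_comm (/ t)). apply Rmult_le_compat; lra.
      * replace ((z - 1) * ln t) with (z * ln t + - ln t) by ring.
        rewrite exp_plus, exp_Ropp, exp_ln by lra. reflexivity.
  - rewrite RInt_const. change ((L + 1 - L) * c = c). ring.
Qed.

Lemma GammaInt_pos (z : R) : 0 < z -> 0 < GammaInt z.
Proof.
  intro Hz. apply Rlt_le_trans with (2 := GammaInt_ge z 1 Hz (Rle_refl 1)).
  apply Rmult_lt_0_compat; [apply exp_pos |].
  apply Rdiv_lt_0_compat; [apply exp_pos | lra].
Qed.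

Definition lnGamma (z : R) : R := ln (GammaInt z).

(** Hoelder's inequality for the Gamma integral.  After normalising both
    integrands to have integral 1, it is the pointwise convexity of exp,
    integrated. *)
Lemma lnGamma_convex (x y l : R) : 0 < x -> 0 < y -> 0 <= l <= 1 ->
  lnGamma (l * x + (1 - l) * y) <= l * lnGamma x + (1 - l) * lnGamma y.
Proof.
  intros Hx Hy Hl.
  assert (Hz : 0 < l * x + (1 - l) * y).
  { destruct (Rle_lt_dec l (1/2)); nra. }
  set (z := l * x + (1 - l) * y) in *.
  set (w := l * lnGamma x + (1 - l) * lnGamma y).
  rewrite <- (ln_exp w). unfold lnGamma at 1.
  apply ln_le; [now apply GammaInt_pos |].
  apply GammaInt_sup; [exact Hz |]. intros a b Hab.
  pose proof (GammaInt_pos x Hx) as HGx. pose proof (GammaInt_pos y Hy) as HGy.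
  set (g := fun t => exp w * (l / GammaInt x) * gamma_integrand x t
    + exp w * ((1 - l) / GammaInt y) * gamma_integrand y t).
  assert (Hex : forall u, ex_RInt (gamma_integrand u) a b).
  { intro u. apply ex_RInt_pos; [apply gamma_integrand_continuous | lra | lra]. }
  assert (HI : is_RInt g a b
    (exp w * (l / GammaInt x) * RInt (gamma_integrand x) a b
    + exp w * ((1 - l) / GammaInt y) * RInt (gamma_integrand y) a b)).
  { apply (is_RInt_plus (V := R_NormedModule));
      apply (is_RInt_scal (V := R_NormedModule)); apply (RInt_correct (V := R_CompleteNormedModule)); apply Hex. }
  apply Rle_trans with (RInt g a b).
  - apply RInt_le; [lra | apply Hex | eexists; exact HI |].
    intros t Ht.
    assert (Et : forall u, 0 < GammaInt u ->
      gamma_integrand u t = GammaInt u * exp ((u - 1) * ln t + - t - lnGamma u)).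
    { intros u Hu. unfold gamma_integrand, Rpower, lnGamma.
      unfold Rminus at 2. rewrite !exp_plus, (exp_Ropp (ln _)), exp_ln by exact Hu.
      field; repeat split; lra. }
    unfold g. rewrite (Et x HGx), (Et y HGy).
    replace (exp w * (l / GammaInt x) * (GammaInt x * exp ((x - 1) * ln t + - t - lnGamma x)) +
     exp w * ((1 - l) / GammaInt y) * (GammaInt y * exp ((y - 1) * ln t + - t - lnGamma y)))
    with (exp w * (l * exp ((x - 1) * ln t + - t - lnGamma x) +
      (1 - l) * exp ((y - 1) * ln t + - t - lnGamma y))) by (field; lra).
    apply Rle_trans with (2 := Rmult_le_compat_l (exp w) _ _ (Rlt_le _ _ (exp_pos w))
      (exp_convex _ _ l Hl)).
    unfold gamma_integrand, Rpower. rewrite <- !exp_plus. right. f_equal.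
    unfold w, z. ring.
  - rewrite (is_RInt_unique _ _ _ _ HI).
    destruct (GammaInt_sup x Hx) as (_ & Bx & _). specialize (Bx a b Hab).
    destruct (GammaInt_sup y Hy) as (_ & By & _). specialize (By a b Hab).
    assert (0 <= l / GammaInt x) by (apply Rdiv_le_0_compat; lra).
    assert (0 <= (1 - l) / GammaInt y) by (apply Rdiv_le_0_compat; lra).
    pose proof (exp_pos w).
    apply Rle_trans with (exp w * (l / GammaInt x) * GammaInt x
      + exp w * ((1 - l) / GammaInt y) * GammaInt y).
    + apply Rplus_le_compat; apply Rmult_le_compat_l; try assumption;
        apply Rmult_le_pos; lra.
    + right. field; repeat split; lra.
Qed.

(** With [Rpower_exp_small_at_infty], the vanishing of the boundary terms in the
    integration by parts behind Gamma(z+1) = z Gamma(z). *)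
Lemma Rpower_exp_small_at_0 (z : R) : 0 < z ->
  filterlim (fun t => - (Rpower t z * exp (- t))) (at_right 0) (locally 0).
Proof.
  intros Hz P [eps HP].
  exists (mkposreal _ (exp_pos (ln eps / z))). intros t Ht Ht0. apply HP.
  change (Rabs (t - 0) < exp (ln eps / z)) in Ht.
  rewrite Rminus_0_r, Rabs_pos_eq in Ht by lra.
  change (Rabs (- (Rpower t z * exp (- t)) - 0) < eps).
  rewrite Rminus_0_r, Rabs_Ropp. unfold Rpower.
  rewrite <- exp_plus, Rabs_pos_eq by (left; apply exp_pos).
  rewrite <- (exp_ln eps) by apply cond_pos. apply exp_increasing.
  apply ln_increasing in Ht; [| exact Ht0]. rewrite ln_exp in Ht.
  apply (Rmult_lt_compat_l z) in Ht; [| exact Hz].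
  replace (z * (ln eps / z)) with (ln eps) in Ht by (field; lra). lra.
Qed.

Lemma Rpower_exp_small_at_infty (z : R) : 0 < z ->
  filterlim (fun t => - (Rpower t z * exp (- t))) (Rbar_locally p_infty) (locally 0).
Proof.
  intros Hz P [eps HP].
  (* The tangent to ln at 2 z gives z ln t <= z (ln (2 z) - 1) + t / 2. *)
  exists (Rmax 1 (2 * (z * (ln (2 * z) - 1) - ln eps))). intros t Ht. apply HP.
  assert (H1 := Rmax_l 1 (2 * (z * (ln (2 * z) - 1) - ln eps))).
  assert (H2 := Rmax_r 1 (2 * (z * (ln (2 * z) - 1) - ln eps))).
  change (Rabs (- (Rpower t z * exp (- t)) - 0) < eps).
  rewrite Rminus_0_r, Rabs_Ropp. unfold Rpower.
  rewrite <- exp_plus, Rabs_pos_eq by (left; apply exp_pos).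
  rewrite <- (exp_ln eps) by apply cond_pos. apply exp_increasing.
  assert (Hl := ln_le_tangent t (2 * z) ltac:(lra) ltac:(lra)).
  apply (Rmult_le_compat_l z) in Hl; [| lra].
  replace (z * (ln (2 * z) + (t - 2 * z) / (2 * z)))
    with (z * (ln (2 * z) - 1) + t / 2) in Hl by (field; lra).
  lra.
Qed.

Lemma at_right_pos_infty_prod (Q : R * R -> Prop) :
  (forall a b, 0 < a < b -> Q (a, b)) ->
  filter_prod (at_right 0) (Rbar_locally p_infty) Q.
Proof.
  intro H.
  apply (Filter_prod _ _ _ (fun a => 0 < a < 1) (fun b => 1 < b)).
  - exists (mkposreal 1 Rlt_0_1). intros y Hy Hy0.
    change (Rabs (y - 0) < 1) in Hy. apply Rabs_def2 in Hy. lra.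
  - now exists 1.
  - intros a b Ha Hb. apply H. lra.
Qed.

Lemma GammaInt_succ (z : R) : 0 < z -> GammaInt (z + 1) = z * GammaInt z.
Proof.
  intro Hz.
  set (B := fun t => - (Rpower t z * exp (- t))).
  set (b := fun t => gamma_integrand (z + 1) t - z * gamma_integrand z t).
  assert (H0 : is_RInt_gen b (at_right 0) (Rbar_locally p_infty) (minus 0 0)).
  { apply (is_RInt_gen_antiderivative (V := R_NormedModule) _ _ _ _ b B).
    - apply at_right_pos_infty_prod. intros u v Huv. simpl.
      apply (is_RInt_derive (V := R_CompleteNormedModule) B b).
      + intros t Ht. rewrite Rmin_left in Ht by lra.
        unfold B, b, gamma_integrand, Rpower. auto_derive; [lra |].
        replace (z + 1 - 1) with z by ring.
        replace ((z - 1) * ln t) with (z * ln t + - ln t) by ring.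
        rewrite exp_plus, (exp_Ropp (ln t)), exp_ln by lra. field. lra.
      + intros t Ht. rewrite Rmin_left in Ht by lra.
        apply (ex_derive_continuous (V := R_NormedModule)).
        unfold b, gamma_integrand, Rpower. auto_derive. lra.
    - now apply Rpower_exp_small_at_0.
    - now apply Rpower_exp_small_at_infty. }
  destruct (GammaInt_sup z Hz) as (Hg & _).
  apply (is_RInt_gen_scal (V := R_NormedModule) _ z) in Hg.
  apply (is_RInt_gen_plus (V := R_NormedModule) _ _ _ _ H0) in Hg.
  unfold GammaInt at 1.
  transitivity (plus (minus 0 0) (scal z (GammaInt z))).
  - apply (is_RInt_gen_unique (V := R_CompleteNormedModule)).
    revert Hg. apply is_RInt_gen_ext.
    apply at_right_pos_infty_prod. intros u v Huv t Ht. simpl in Ht.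
    unfold b, gamma_integrand.
    change ((Rpower t (z + 1 - 1) * exp (- t) - z * (Rpower t (z - 1) * exp (- t)))
      + z * (Rpower t (z - 1) * exp (- t)) = Rpower t (z + 1 - 1) * exp (- t) :> R). ring.
  - change ((0 - 0) + z * GammaInt z = z * GammaInt z). ring.
Qed.

Lemma GammaInt_1 : GammaInt 1 = 1.
Proof.
  unfold GammaInt.
  transitivity (minus 0 (- exp (- 0))).
  - apply (is_RInt_gen_unique (V := R_CompleteNormedModule)).
    apply (is_RInt_gen_ext (fun t => exp (- t))).
    + apply at_right_pos_infty_prod. intros u v Huv t Ht. simpl in Ht.
      rewrite Rmin_left in Ht by lra.
      replace (1 - 1) with 0 by ring. rewrite Rpower_O by lra. apply eq_sym, Rmult_1_l.
    + apply (is_RInt_gen_antiderivative (V := R_NormedModule) _ _ _ _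
        (fun t => exp (- t)) (fun t => - exp (- t))).
      * apply at_right_pos_infty_prod. intros u v Huv. simpl.
        apply (is_RInt_derive (V := R_CompleteNormedModule)
          (fun t => - exp (- t)) (fun t => exp (- t))).
        -- intros t _. auto_derive; [exact I | ring].
        -- intros t _. apply (ex_derive_continuous (V := R_NormedModule)).
           now auto_derive.
      * assert (Hc : continuous (fun t => - exp (- t)) 0).
        { apply (ex_derive_continuous (V := R_NormedModule)). now auto_derive. }
        apply filterlim_filter_le_1 with (2 := Hc). apply filter_le_within.
      * intros P [eps HP]. exists (- ln eps). intros t Ht. apply HP.
        change (Rabs (- exp (- t) - 0) < eps).
        rewrite Rminus_0_r, Rabs_Ropp, Rabs_pos_eq by (left; apply exp_pos).
        rewrite <- (exp_ln eps) by apply cond_pos. apply exp_increasing. lra.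
  - change (0 - - exp (- 0) = 1). rewrite Ropp_0, exp_0. ring.
Qed.

Lemma lnGamma_succ (z : R) : 0 < z -> lnGamma (z + 1) = lnGamma z + ln z.
Proof.
  intro Hz. unfold lnGamma. rewrite GammaInt_succ by exact Hz.
  rewrite ln_mult; [ring | exact Hz | now apply GammaInt_pos].
Qed.

(** * The digamma function *)

(** Chord slopes of a convex function increase, in division-free form. *)
Lemma lnGamma_three_chords (a b c : R) : 0 < a -> a <= b <= c ->
  (lnGamma b - lnGamma a) * (c - b) <= (lnGamma c - lnGamma b) * (b - a).
Proof.
  intros Ha Hb.
  destruct (Req_dec a c) as [E | E].
  - replace b with a by lra. subst c. lra.
  - assert (H := lnGamma_convex a c ((c - b) / (c - a)) Ha ltac:(lra)).
    replace ((c - b) / (c - a) * a + (1 - (c - b) / (c - a)) * c) with b in H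
      by (field; lra).
    assert (Hl : 0 <= (c - b) / (c - a) <= 1).
    { split; [apply Rdiv_le_0_compat; lra |].
      apply Rmult_le_reg_r with (c - a); [lra |]. unfold Rdiv.
      rewrite Rmult_assoc, Rinv_l; lra. }
    specialize (H Hl).
    apply (Rmult_le_compat_l (c - a)) in H; [| lra].
    replace ((c - a) * ((c - b) / (c - a) * lnGamma a +
      (1 - (c - b) / (c - a)) * lnGamma c)) with
      ((c - b) * lnGamma a + (b - a) * lnGamma c) in H by (field; lra).
    nra.
Qed.

(** The chord over [b, b+1] has slope ln b and dominates every chord to its left.
    The lower bound shifts the chord by 1 with the functional equation and
    compares it with the chord over [a, a+1], of slope ln a. *)
Lemma lnGamma_slope (a b : R) : 0 < a -> a <= b ->
  (b - a) * (ln a - 1 / a) <= lnGamma b - lnGamma a <= (b - a) * ln b.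
Proof.
  intros Ha Hb. split.
  - assert (H := lnGamma_three_chords a (a + 1) (b + 1) Ha ltac:(lra)).
    rewrite !lnGamma_succ in H by lra.
    assert (Hl := ln_le_tangent b a ltac:(lra) Ha).
    replace ((b - a) * (ln a - 1 / a)) with ((b - a) * ln a - (b - a) / a)
      by (field; lra).
    lra.
  - assert (H := lnGamma_three_chords a b (b + 1) Ha ltac:(lra)).
    rewrite lnGamma_succ in H by lra. lra.
Qed.

(** The correction S is the sum of ln (u + i) for i < M; only its
    differentiability matters. *)
Lemma lnGamma_shift (M : nat) : exists S : R -> R,
  forall u, 0 < u -> lnGamma (u + INR M) = lnGamma u + S u /\ ex_derive S u.
Proof.
  induction M as [| M [S HS]].
  - exists (fun _ => 0). intros u Hu. simpl. split; [| apply ex_derive_const].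
    now rewrite !Rplus_0_r.
  - exists (fun u => S u + ln (u + INR M)). intros u Hu.
    pose proof (pos_INR M). destruct (HS u Hu) as [E D]. split.
    + rewrite S_INR, <- Rplus_assoc, lnGamma_succ, E by lra. ring.
    + apply (ex_derive_plus (V := R_NormedModule)); [exact D |].
      auto_derive. lra.
Qed.

Lemma ex_derive_of_quotient_cauchy (f : R -> R) (x : R) :
  (forall eps : posreal, exists d : posreal, forall h k,
    h <> 0 -> Rabs h < d -> k <> 0 -> Rabs k < d ->
    Rabs ((f (x + k) - f x) / k - (f (x + h) - f x) / h) < eps) ->
  ex_derive f x.
Proof.
  intro H.
  destruct (proj1 (filterlim_locally_cauchy (U := R_CompleteSpace)
    (F := Rbar_locally' (Finite 0)) (fun h => (f (x + h) - f x) / h))) as [l Hl].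
  - intro eps. destruct (H eps) as [d Hd].
    exists (fun h => h <> 0 /\ Rabs h < d). split.
    + exists d. intros y Hy Hy0. split; [exact Hy0 |].
      change (Rabs (y - 0) < d) in Hy. now rewrite Rminus_0_r in Hy.
    + intros h k [Hh Hh'] [Hk Hk']. now apply Hd.
  - exists l. apply is_derive_Reals. intros eps Heps.
    destruct (Hl (ball l (mkposreal eps Heps)) (locally_ball _ _)) as [d Hd].
    exists d. intros h Hh Hh'. apply (Hd h); [| exact Hh].
    change (Rabs (h - 0) < d). now rewrite Rminus_0_r.
Qed.

(** The two bounds do not depend on h and differ by 3 / (y - 1), so that far out
    all small difference quotients nearly agree. *)
Lemma lnGamma_quotient (y h : R) : 1 < y -> h <> 0 -> Rabs h < 1 ->
  ln (y - 1) - 1 / (y - 1) <= (lnGamma (y + h) - lnGamma y) / h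
    <= ln (y - 1) + 2 / (y - 1).
Proof.
  intros Hy Hh Hh1. apply Rabs_def2 in Hh1.
  assert (Hln : forall u, y - 1 <= u -> ln (y - 1) - 1 / (y - 1) <= ln u - 1 / u).
  { intros u Hu. assert (ln (y - 1) <= ln u) by (apply ln_le; lra).
    assert (/ u <= / (y - 1)) by (apply Rinv_le_contravar; lra). lra. }
  assert (Hln' : forall u, 0 < u -> u <= y + 1 -> ln u <= ln (y - 1) + 2 / (y - 1)).
  { intros u Hu Hu'. apply Rle_trans with (1 := ln_le _ _ Hu Hu').
    replace (2 / (y - 1)) with ((y + 1 - (y - 1)) / (y - 1)) by (field; lra).
    apply ln_le_tangent; lra. }
  destruct (Rdichotomy _ _ Hh) as [Hneg | Hpos].
  - destruct (lnGamma_slope (y + h) y ltac:(lra) ltac:(lra)) as [H1 H2].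
    replace ((lnGamma (y + h) - lnGamma y) / h) with ((lnGamma y - lnGamma (y + h)) / (- h))
      by (field; lra).
    specialize (Hln (y + h) ltac:(lra)). specialize (Hln' y ltac:(lra) ltac:(lra)).
    split.
    + apply Rle_trans with (1 := Hln). apply Rle_div_r; [lra |].
      replace (- h) with (y - (y + h)) by ring. lra.
    + apply Rle_trans with (2 := Hln'). apply Rle_div_l; [lra |].
      replace (- h) with (y - (y + h)) by ring. lra.
  - destruct (lnGamma_slope y (y + h) ltac:(lra) ltac:(lra)) as [H1 H2].
    specialize (Hln y ltac:(lra)). specialize (Hln' (y + h) ltac:(lra) ltac:(lra)).
    replace (y + h - y) with h in * by ring.
    split.
    + apply Rle_trans with (1 := Hln). apply Rle_div_r; lra.
    + apply Rle_trans with (2 := Hln'). apply Rle_div_l; lra.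
Qed.

(** Differentiability at x is checked at x + M, where the difference quotients
    oscillate by at most 3 / (x + M - 1); going back to x subtracts the
    quotients of a fixed differentiable function. *)
Lemma ex_derive_lnGamma (x : R) : 0 < x -> ex_derive lnGamma x.
Proof.
  intro Hx. apply ex_derive_of_quotient_cauchy. intro eps.
  pose proof (cond_pos eps) as Heps.
  (* This M makes the oscillation 3 / (x + M - 1) smaller than eps / 2. *)
  destruct (INR_unbounded (1 + 6 / eps)) as [M HM].
  assert (H6 : 0 < 6 / eps) by (apply Rdiv_lt_0_compat; lra).
  destruct (lnGamma_shift M) as [S HS].
  destruct (HS x Hx) as [_ [s Hs]]. apply is_derive_Reals in Hs.
  destruct (Hs (eps / 4) ltac:(lra)) as [d Hd].
  assert (Hm : 0 < Rmin d (Rmin 1 x)).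
  { repeat apply Rmin_glb_lt; [apply cond_pos | lra | exact Hx]. }
  exists (mkposreal _ Hm). simpl.
  assert (Hq : forall h, h <> 0 -> Rabs h < Rmin d (Rmin 1 x) ->
    exists p r, (lnGamma (x + h) - lnGamma x) / h = p - r /\
      ln (x + INR M - 1) - 1 / (x + INR M - 1) <= p
        <= ln (x + INR M - 1) + 2 / (x + INR M - 1) /\
      - (eps / 4) < r - s < eps / 4).
  { intros h Hh Hhm.
    assert (Hd1 : Rabs h < d) by (apply Rlt_le_trans with (1 := Hhm); apply Rmin_l).
    assert (Hd2 : Rabs h < Rmin 1 x) by (apply Rlt_le_trans with (1 := Hhm); apply Rmin_r).
    assert (Hd3 : Rabs h < 1) by (apply Rlt_le_trans with (1 := Hd2); apply Rmin_l).
    assert (Hd4 : Rabs h < x) by (apply Rlt_le_trans with (1 := Hd2); apply Rmin_r).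
    apply Rabs_def2 in Hd4.
    exists ((lnGamma (x + INR M + h) - lnGamma (x + INR M)) / h), ((S (x + h) - S x) / h).
    split; [| split].
    - replace (x + INR M + h) with (x + h + INR M) by ring.
      rewrite (proj1 (HS x Hx)), (proj1 (HS (x + h) ltac:(lra))). now field.
    - apply lnGamma_quotient; [lra | exact Hh | exact Hd3].
    - specialize (Hd h Hh Hd1). apply Rabs_def2 in Hd. lra. }
  intros h k Hh Hh1 Hk Hk1.
  destruct (Hq h Hh Hh1) as (p & r & -> & Hp & Hr).
  destruct (Hq k Hk Hk1) as (p' & r' & -> & Hp' & Hr').
  assert (Hy : 3 / (x + INR M - 1) < eps / 2).
  { apply Rlt_div_l; [lra |].
    apply Rle_lt_trans with (eps / 2 * (6 / eps)); [right; field; lra |].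
    apply Rmult_lt_compat_l; lra. }
  apply Rabs_def1; lra.
Qed.

Definition digamma (x : R) : R := Derive lnGamma x.

Lemma is_derive_lnGamma (x : R) : 0 < x -> is_derive lnGamma x (digamma x).
Proof. intro Hx. apply Derive_correct. now apply ex_derive_lnGamma. Qed.

Lemma digamma_succ (x : R) : 0 < x -> digamma (x + 1) = digamma x + 1 / x.
Proof.
  intro Hx. symmetry.
  transitivity (Derive (fun u => lnGamma (u + 1)) x).
  - symmetry. apply is_derive_unique.
    apply (is_derive_ext_loc (fun u => lnGamma u + ln u)).
    + exists (mkposreal x Hx). intros u Hu. change (Rabs (u - x) < x) in Hu.
      apply Rabs_def2 in Hu. symmetry. apply lnGamma_succ. lra.
    + apply (is_derive_plus (V := R_NormedModule)); [now apply is_derive_lnGamma |].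
      auto_derive; [exact Hx | field; lra].
  - apply is_derive_unique.
    evar_last.
    + apply (is_derive_comp (V := R_NormedModule) lnGamma (fun u => u + 1)).
      * apply is_derive_lnGamma. lra.
      * auto_derive; [exact I | reflexivity].
    + change (1 * digamma (x + 1) = digamma (x + 1)). ring.
Qed.

(** The chord bounds of [lnGamma_slope], passed to the limit: chords on the right
    of x give the lower bound, chords on the left the upper one. *)
Lemma digamma_bounds (x : R) : 0 < x -> ln x - 1 / x <= digamma x <= ln x.
Proof.
  intro Hx. pose proof (is_derive_lnGamma x Hx) as H. apply is_derive_Reals in H.
  split; apply le_epsilon; intros eps Heps; destruct (H eps Heps) as [d Hd].
  - assert (Hp := cond_pos d).
    specialize (Hd (d / 2) ltac:(lra) ltac:(rewrite Rabs_pos_eq; lra)).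
    destruct (lnGamma_slope x (x + d / 2) Hx ltac:(lra)) as [Hs _].
    replace (x + d / 2 - x) with (d / 2) in Hs by ring.
    apply Rabs_def2 in Hd.
    assert (ln x - 1 / x <= (lnGamma (x + d / 2) - lnGamma x) / (d / 2)).
    { apply Rle_div_r; lra. }
    lra.
  - assert (Hm : 0 < Rmin d x / 2).
    { apply Rdiv_lt_0_compat; [| lra]. apply Rmin_glb_lt; [apply cond_pos | exact Hx]. }
    assert (Hm1 := Rmin_l d x). assert (Hm2 := Rmin_r d x).
    set (e := Rmin d x / 2) in *.
    assert (He : e < d /\ e < x) by (unfold e; unfold e in Hm; lra).
    specialize (Hd (- e) ltac:(lra) ltac:(rewrite Rabs_Ropp, Rabs_pos_eq; lra)).
    destruct (lnGamma_slope (x + - e) x ltac:(lra) ltac:(lra)) as [_ Hs].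
    apply Rabs_def2 in Hd.
    replace ((lnGamma (x + - e) - lnGamma x) / - e)
      with ((lnGamma x - lnGamma (x + - e)) / e) in Hd by (field; lra).
    replace (x - (x + - e)) with e in Hs by ring.
    assert ((lnGamma x - lnGamma (x + - e)) / e <= ln x).
    { apply Rle_div_l; lra. }
    lra.
Qed.

Lemma rGamma_pos (z : R) : 0 < z -> rGamma z = exp (- lnGamma z).
Proof.
  intro Hz. unfold rGamma.
  assert (Hu : (up (- z) <= 0)%Z).
  { destruct (archimed (- z)) as [_ H]. apply Z.lt_succ_r, lt_IZR. simpl. lra. }
  replace (Z.to_nat (up (- z))) with 0%nat by lia.
  simpl. rewrite Rplus_0_r, exp_Ropp. unfold lnGamma.
  rewrite exp_ln by now apply GammaInt_pos. unfold Rdiv. ring.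
Qed.

Lemma is_derive_rGamma (y : R) : 0 < y -> is_derive rGamma y (- digamma y * rGamma y).
Proof.
  intro Hy.
  apply (is_derive_ext_loc (fun z => exp (- lnGamma z))).
  - exists (mkposreal _ Hy). intros u Hu. change (Rabs (u - y) < y) in Hu.
    apply Rabs_def2 in Hu. symmetry. apply rGamma_pos. lra.
  - rewrite rGamma_pos by exact Hy. evar_last.
    + apply (is_derive_comp (V := R_NormedModule) (fun u => exp (- u)) lnGamma).
      * auto_derive; [exact I | reflexivity].
      * now apply is_derive_lnGamma.
    + change (digamma y * (- (1) * exp (- lnGamma y)) = - digamma y * exp (- lnGamma y)).
      ring.
Qed.

Lemma GammaInt_fact (j : nat) : GammaInt (INR (S j)) = INR (fact j).
Proof.
  induction j as [| j IH].
  - exact GammaInt_1.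
  - rewrite S_INR, GammaInt_succ by (apply lt_0_INR; lia).
    rewrite IH. change (fact (S j)) with (S j * fact j)%nat. now rewrite mult_INR.
Qed.

(** * Decay of the reciprocal Gamma function *)

Lemma digamma_abs_le (y : R) : 1 / 2 <= y -> Rabs (digamma y) <= y + 3.
Proof.
  intro Hy. destruct (digamma_bounds y ltac:(lra)) as [H1 H2].
  assert (H3 := ln_le_tangent y 1 ltac:(lra) ltac:(lra)).
  assert (H4 := ln_le_tangent 1 y ltac:(lra) ltac:(lra)). rewrite ln_1 in *.
  replace ((1 - y) / y) with (1 / y - 1) in H4 by (field; lra).
  assert (/ y <= / (1 / 2)) by (apply Rinv_le_contravar; lra).
  apply Rabs_le. lra.
Qed.

(** Taking L = q^2 in [GammaInt_ge] turns the exponent y >= k/2 into a factor q^k. *)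
Lemma rGamma_decay (q : R) : 1 <= q -> exists c, 0 < c /\
  forall (k : nat) (y : R), (1 <= k)%nat -> INR k / 2 <= y -> 0 < rGamma y <= c / q ^ k.
Proof.
  intro Hq. set (L := q * q). assert (HL : 1 <= L) by (unfold L; nra).
  exists (/ (exp (- (L + 1)) / (L + 1))).
  assert (Hc : 0 < exp (- (L + 1)) / (L + 1))
    by (apply Rdiv_lt_0_compat; [apply exp_pos | lra]).
  split; [now apply Rinv_0_lt_compat |].
  intros k y Hk Hy. assert (Hk' : 1 <= INR k) by now apply (le_INR 1).
  rewrite rGamma_pos by lra. split; [apply exp_pos |].
  unfold lnGamma. rewrite exp_Ropp, exp_ln by (apply GammaInt_pos; lra).
  assert (H := GammaInt_ge y L ltac:(lra) HL).
  assert (Hqk : 0 < q ^ k) by (apply pow_lt; lra).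
  assert (HR : q ^ k <= Rpower L y).
  { replace (q ^ k) with (Rpower L (INR k / 2)).
    - apply Rle_Rpower; lra.
    - unfold L, Rpower. rewrite ln_mult by lra.
      replace (INR k / 2 * (ln q + ln q)) with (INR k * ln q) by field.
      apply Rpower_pow. lra. }
  unfold Rdiv at 1. rewrite <- Rinv_mult. apply Rinv_le_contravar.
  - now apply Rmult_lt_0_compat.
  - apply Rle_trans with (2 := H). rewrite Rmult_comm.
    apply Rmult_le_compat_r; [lra | exact HR].
Qed.

(** The Lipschitz constant is affine in the position, so after multiplication by
    the decay D of [rGamma_decay] it stays summable in k. *)
Lemma rGamma_lipschitz (k : nat) (D a b : R) : (1 <= k)%nat ->
  INR k <= a -> Rabs (b - a) <= INR k / 2 ->
  (forall y, INR k / 2 <= y -> 0 < rGamma y <= D) ->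
  Rabs (rGamma b - rGamma a) <= (a + INR k + 3) * D * Rabs (b - a).
Proof.
  intros Hk Ha Hb HD. assert (Hk' : 1 <= INR k) by now apply (le_INR 1).
  apply (bounded_variation rGamma (fun y => - digamma y * rGamma y)).
  intros t Ht. apply Rle_trans with (2 := Hb) in Ht. apply Rabs_le_between in Ht.
  split; [apply is_derive_rGamma; lra |].
  destruct (HD t ltac:(lra)) as [H1 H2].
  rewrite Rabs_mult, Rabs_Ropp, (Rabs_pos_eq (rGamma t)) by lra.
  apply Rmult_le_compat; [apply Rabs_pos | lra | | exact H2].
  apply Rle_trans with (1 := digamma_abs_le t ltac:(lra)). lra.
Qed.

(** * Termwise differentiation of a series *)

Lemma is_derive_locally {V : NormedModule R_AbsRing} (f : R -> V) (x : R) (l : V) :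
  is_derive f x l <->
  forall eps : posreal, locally x (fun y : R =>
    norm (minus (minus (f y) (f x)) (scal (y - x) l)) <= eps * Rabs (y - x)).
Proof.
  split.
  - intros [_ H]. exact (H x (fun P HP => HP)).
  - intro H. split; [apply is_linear_scal_l |].
    intros x' Hx'.
    rewrite <- (is_filter_lim_locally_unique (V := R_NormedModule) x x' Hx'). exact H.
Qed.

Lemma minus_minus_cancel {G : AbelianGroup} (a b : G) : minus a (minus a b) = b.
Proof.
  transitivity (plus a (plus (opp a) b)).
  - unfold minus. f_equal. transitivity (plus (opp a) (opp (opp b))).
    + apply opp_plus.
    + f_equal. apply opp_opp.
  - transitivity (plus (plus a (opp a)) b); [apply plus_assoc |].
    transitivity (plus zero b); [f_equal; apply plus_opp_r | apply plus_zero_l].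
Qed.

Lemma norm_derive_le {V : NormedModule R_AbsRing} (f : R -> V) (x : R) (l : V)
  (r : posreal) (M : R) :
  is_derive f x l ->
  (forall y, Rabs (y - x) < r -> norm (minus (f y) (f x)) <= M * Rabs (y - x)) ->
  norm l <= M.
Proof.
  intros Hd HM. apply le_epsilon. intros eps Heps.
  destruct (proj1 (is_derive_locally f x l) Hd (mkposreal eps Heps)) as [d H].
  set (h := Rmin d r / 2).
  assert (Hm : 0 < Rmin d r) by (apply Rmin_glb_lt; apply cond_pos).
  assert (H1 := Rmin_l d r). assert (H2 := Rmin_r d r).
  assert (Hh : 0 < h < Rmin d r) by (unfold h; lra).
  assert (Eh : x + h - x = h) by ring.
  assert (Ha : Rabs (x + h - x) = h) by (rewrite Eh; apply Rabs_pos_eq; lra).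
  specialize (H (x + h)). specialize (HM (x + h)). rewrite Ha in *.
  assert (Hb : ball x d (x + h)).
  { change (Rabs (x + h - x) < d). rewrite Ha. lra. }
  specialize (H Hb). specialize (HM ltac:(lra)). simpl in H. rewrite Eh in H.
  set (a := minus (f (x + h)) (f x)) in *.
  assert (E : scal h l = minus a (minus a (scal h l))).
  { symmetry. apply minus_minus_cancel. }
  assert (Hs : norm (scal h l) <= (M + eps) * h).
  { rewrite E. unfold minus at 1.
    apply Rle_trans with (1 := norm_triangle _ _). rewrite norm_opp. lra. }
  replace l with (scal (/ h) (scal h l)).
  - apply Rle_trans with (1 := norm_scal (V := V) (/ h) (scal h l)).
    change (abs (/ h)) with (Rabs (/ h)).
    rewrite Rabs_inv, (Rabs_pos_eq h) by lra.
    apply Rmult_le_reg_l with h; [lra |].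
    rewrite <- Rmult_assoc, Rinv_r by lra. lra.
  - rewrite scal_assoc. replace (mult (/ h) h) with (one : R_AbsRing).
    + apply (scal_one (V := V)).
    + symmetry. apply Rinv_l. lra.
Qed.

(** The increment of the series minus its linear part is split at an index N: the
    tail is at most [2 |y - x|] times the tail of the Lipschitz constants,
    uniformly in y, and the head is a finite sum of differentiable functions. *)
Lemma is_derive_series {V : NormedModule R_AbsRing}
  (u : nat -> R -> V) (d : nat -> V) (U : R -> V) (D : V) (M : nat -> R)
  (x : R) (r : posreal) :
  (forall k, is_derive (u k) x (d k)) ->
  (forall k y, Rabs (y - x) < r ->
    norm (minus (u k y) (u k x)) <= M k * Rabs (y - x)) ->
  ex_series M ->
  (forall y, Rabs (y - x) < r -> is_series (fun k => u k y) (U y)) ->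
  is_series d D ->
  is_derive U x D.
Proof.
  intros Hd HM [S HS] HU HD.
  set (v := fun k y => minus (minus (u k y) (u k x)) (scal (y - x) (d k))).
  assert (Hv : forall k, is_derive (v k) x zero).
  { intro k. unfold v.
    evar_last.
    - apply is_derive_minus.
      + apply is_derive_minus; [apply Hd | apply is_derive_const].
      + apply (is_derive_scal_l (V := V) (fun y => y - x) x 1).
        auto_derive; [exact I | ring].
    - transitivity (minus (d k) (d k)); [| apply (minus_eq_zero (G := V))].
      f_equal; [apply (minus_zero_r (G := V)) | apply (scal_one (V := V))]. }
  assert (Hvx : forall k, v k x = zero).
  { intro k. unfold v. rewrite Rminus_diag.
    transitivity (minus (zero : V) zero); [| apply (minus_eq_zero (G := V))].
    f_equal; [apply (minus_eq_zero (G := V)) | apply (scal_zero_l (V := V))]. }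
  assert (HM0 : forall k, 0 <= M k).
  { intro k. apply Rle_trans with (norm (d k)); [apply norm_ge_0 |].
    apply norm_derive_le with (1 := Hd k) (r := r). apply HM. }
  assert (Hvn : forall k y, Rabs (y - x) < r -> norm (v k y) <= 2 * Rabs (y - x) * M k).
  { intros k y Hy. unfold v, minus at 1.
    apply Rle_trans with (1 := norm_triangle _ _). rewrite norm_opp.
    assert (Hs : norm (scal (y - x) (d k)) <= Rabs (y - x) * norm (d k))
      by apply (norm_scal (V := V)).
    assert (norm (d k) <= M k).
    { apply norm_derive_le with (1 := Hd k) (r := r). apply HM. }
    assert (Rabs (y - x) * norm (d k) <= Rabs (y - x) * M k)
      by (apply Rmult_le_compat_l; [apply Rabs_pos | assumption]).
    specialize (HM k y Hy). lra. }
  apply is_derive_locally. intro eps.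
  assert (HSe : exists N, forall n, (N <= n)%nat -> sum_n_m M (Datatypes.S N) n <= eps / 4).
  { destruct (HS (ball S (pos_div_2 (pos_div_2 eps))) (locally_ball _ _)) as [N HN].
    exists N. intros n Hn. specialize (HN N (le_n _)).
    assert (Hle : sum_n M n <= S).
    { apply (is_lim_seq_incr_compare (sum_n M) S HS). intro k. rewrite sum_Sn.
      specialize (HM0 (Datatypes.S k)).
      change (sum_n M k <= sum_n M k + M (Datatypes.S k)). lra. }
    unfold sum_n in Hle. rewrite (sum_n_m_Chasles M 0 N n) in Hle by lia.
    change (sum_n M N + sum_n_m M (Datatypes.S N) n <= S) in Hle.
    change (Rabs (sum_n M N - S) < eps / 2 / 2) in HN.
    apply Rabs_def2 in HN. lra. }
  destruct HSe as [N HN].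
  assert (HF : is_derive (fun y => sum_n (fun k => v k y) N) x zero).
  { evar_last.
    - apply (is_derive_sum_n v N x (fun _ => zero)). intros k _. apply Hv.
    - apply (sum_n_m_const_zero (G := V)). }
  destruct (proj1 (is_derive_locally _ _ _) HF (pos_div_2 eps)) as [e He].
  exists (mkposreal _ (Rmin_stable_in_posreal e r)). intros y Hy.
  change (Rabs (y - x) < Rmin e r) in Hy.
  assert (Hye : Rabs (y - x) < e) by (apply Rlt_le_trans with (1 := Hy); apply Rmin_l).
  assert (Hyr : Rabs (y - x) < r) by (apply Rlt_le_trans with (1 := Hy); apply Rmin_r).
  assert (Hx : Rabs (x - x) < r).
  { rewrite Rminus_diag, Rabs_R0. apply cond_pos. }
  assert (Hsv : is_series (fun k => v k y)
    (minus (minus (U y) (U x)) (scal (y - x) D))).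
  { apply is_series_minus; [apply is_series_minus; now apply HU |].
    now apply (is_series_scal (V := V)). }
  assert (Hhead : norm (sum_n (fun k => v k y) N) <= eps / 2 * Rabs (y - x)).
  { specialize (He y Hye). simpl in He.
    replace (sum_n (fun k => v k y) N) with
      (minus (minus (sum_n (fun k => v k y) N) (sum_n (fun k => v k x) N))
        (scal (y - x) zero)); [exact He |].
    transitivity (minus (sum_n (fun k => v k y) N) zero); [| apply (minus_zero_r (G := V))].
    f_equal; [| apply (scal_zero_r (V := V))].
    transitivity (minus (sum_n (fun k => v k y) N) zero); [| apply (minus_zero_r (G := V))].
    f_equal. rewrite (sum_n_ext _ (fun _ => zero)) by apply Hvx.
    apply (sum_n_m_const_zero (G := V)). }
  assert (Hbound : forall n, (N <= n)%nat ->
    norm (sum_n (fun k => v k y) n) <= eps * Rabs (y - x)).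
  { intros n Hn. unfold sum_n. rewrite (sum_n_m_Chasles _ 0 N n) by lia.
    apply Rle_trans with (1 := norm_triangle _ _).
    assert (Ht : norm (sum_n_m (fun k => v k y) (Datatypes.S N) n)
      <= 2 * Rabs (y - x) * (eps / 4)).
    { apply Rle_trans with (1 := norm_sum_n_m _ _ _).
      apply Rle_trans with (sum_n_m (fun k => mult (2 * Rabs (y - x)) (M k)) (Datatypes.S N) n).
      - apply sum_n_m_le. intro k. now apply Hvn.
      - rewrite (sum_n_m_mult_l (K := R_Ring)).
        apply Rmult_le_compat_l; [pose proof (Rabs_pos (y - x)); lra |].
        now apply HN. }
    unfold sum_n in Hhead. lra. }
  assert (Hlim : is_lim_seq (fun n => norm (sum_n (fun k => v k y) n))
    (norm (minus (minus (U y) (U x)) (scal (y - x) D)))).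
  { apply (filterlim_comp _ _ _ _ norm _ _ _ Hsv). apply filterlim_norm. }
  apply (is_lim_seq_incr_n _ N) in Hlim.
  apply (is_lim_seq_le _ _ _ (Finite (eps * Rabs (y - x)))) with (2 := Hlim)
    (3 := is_lim_seq_const _).
  intro n. apply Hbound. lia.
Qed.

(** * Complex-valued functions of a real variable *)

Local Notation is_Cderive := (is_derive (K := R_AbsRing) (V := C_R_NormedModule)).
Local Notation is_Cseries := (is_series (K := R_AbsRing) (V := C_R_NormedModule)).

Lemma is_Cderive_iff (f : R -> C) (s : R) (l : C) :
  is_Cderive f s l <->
  is_derive (fun u => Re (f u)) s (Re l) /\ is_derive (fun u => Im (f u)) s (Im l).
Proof.
  split.
  - intro H. split.
    + refine (filterdiff_comp' (W := R_NormedModule) f Re s _ Re H _).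
      apply filterdiff_linear, is_linear_fst.
    + refine (filterdiff_comp' (W := R_NormedModule) f Im s _ Im H _).
      apply filterdiff_linear, is_linear_snd.
  - intros [H1 H2].
    apply (is_derive_scal_l (V := C_R_NormedModule) _ _ _ (RtoC 1)) in H1.
    apply (is_derive_scal_l (V := C_R_NormedModule) _ _ _ Ci) in H2.
    assert (E : forall z : C, plus (scal (Re z) (RtoC 1 : C_R_NormedModule))
       (scal (Im z) (Ci : C_R_NormedModule)) = z).
    { intros [a b]. apply injective_projections; simpl.
      - change (a * 1 + b * 0 = a). ring.
      - change (a * 0 + b * 1 = b). ring. }
    evar_last.
    + apply (is_derive_ext _ _ _ _ (fun t => E (f t))).
      apply (is_derive_plus (V := C_R_NormedModule)); [exact H1 | exact H2].
    + apply E.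
Qed.

Lemma is_Cderive_RtoC (f : R -> R) (s l : R) :
  is_derive f s l -> is_Cderive (fun u => RtoC (f u)) s (RtoC l).
Proof.
  intro H. apply is_Cderive_iff. split; [exact H |].
  exact (is_derive_const (V := R_NormedModule) 0 s).
Qed.

Lemma is_Cderive_mult (f g : R -> C) (s : R) (df dg : C) :
  is_Cderive f s df -> is_Cderive g s dg ->
  is_Cderive (fun u => f u * g u)%C s (df * g s + f s * dg)%C.
Proof.
  intros Hf Hg. apply is_Cderive_iff in Hf. apply is_Cderive_iff in Hg.
  destruct Hf as [F1 F2], Hg as [G1 G2]. apply is_Cderive_iff.
  assert (Hm : forall (p q : R -> R) dp dq, is_derive p s dp -> is_derive q s dq ->
    is_derive (fun u => p u * q u) s (dp * q s + p s * dq)).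
  { intros p q dp dq Hp Hq.
    apply (is_derive_mult p q s dp dq Hp Hq). intros; apply Rmult_comm. }
  split; simpl.
  - evar_last.
    + apply (is_derive_minus (V := R_NormedModule));
        [exact (Hm _ _ _ _ F1 G1) | exact (Hm _ _ _ _ F2 G2)].
    + unfold minus, plus, opp, Re, Im; simpl. ring.
  - evar_last.
    + apply (is_derive_plus (V := R_NormedModule));
        [exact (Hm _ _ _ _ F1 G2) | exact (Hm _ _ _ _ F2 G1)].
    + unfold minus, plus, opp, Re, Im; simpl. ring.
Qed.

Lemma is_Cderive_line (z v : C) (s : R) : is_Cderive (fun u => z + RtoC u * v)%C s v.
Proof.
  apply is_Cderive_iff. simpl. split; (auto_derive; [exact I | unfold Re, Im; ring]).
Qed.

Lemma Cexp_line (z v : C) (s : R) :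
  is_Cderive (fun u => Cexp (z + RtoC u * v)) s (v * Cexp (z + RtoC s * v))%C.
Proof.
  apply is_Cderive_iff. unfold Cexp, Re, Im; simpl. split.
  - auto_derive; [exact I |]. unfold Rminus. ring.
  - auto_derive; [exact I |]. unfold Rminus. ring.
Qed.

Lemma Cexp_plus (z w : C) : Cexp (z + w) = (Cexp z * Cexp w)%C.
Proof.
  unfold Cexp, Re, Im. simpl. rewrite exp_plus, cos_plus, sin_plus.
  apply injective_projections; simpl; ring.
Qed.

Lemma Cexp_RtoC (r : R) : Cexp (RtoC r) = RtoC (exp r).
Proof.
  unfold Cexp, RtoC, Re, Im. simpl. rewrite cos_0, sin_0.
  apply injective_projections; simpl; ring.
Qed.

Lemma Cexp_0 : Cexp 0 = 1.
Proof. rewrite Cexp_RtoC, exp_0. reflexivity. Qed.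

Lemma Cmod_Cexp (z : C) : Cmod (Cexp z) = exp (Re z).
Proof.
  unfold Cmod, Cexp. simpl.
  replace (exp (Re z) * cos (Im z) * (exp (Re z) * cos (Im z) * 1) +
    exp (Re z) * sin (Im z) * (exp (Re z) * sin (Im z) * 1))
    with (exp (Re z) * exp (Re z)).
  - apply sqrt_square. left. apply exp_pos.
  - pose proof (sin2_cos2 (Im z)) as H. unfold Rsqr in H. nra.
Qed.

Lemma Cexp_neq_0 (z : C) : Cexp z <> 0.
Proof.
  intro H. pose proof (Cmod_Cexp z) as E. rewrite H, Cmod_0 in E.
  pose proof (exp_pos (Re z)). lra.
Qed.

Lemma Cexp_opp_mult (z : C) : (Cexp (- z) * Cexp z)%C = 1.
Proof.
  rewrite <- Cexp_plus. replace (- z + z)%C with (RtoC 0) by ring. apply Cexp_0.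
Qed.

Lemma Cexp_pow (z : C) (k : nat) : (Cexp z ^ k)%C = Cexp (RtoC (INR k) * z).
Proof.
  induction k as [| k IH].
  - simpl. rewrite <- Cexp_0. f_equal. ring.
  - rewrite Cpow_S, IH, <- Cexp_plus, S_INR, RtoC_plus. f_equal. ring.
Qed.

Lemma is_Cseries_mult_l (w : C) (a : nat -> C) (l : C) :
  is_Cseries a l -> is_Cseries (fun j => w * a j)%C (w * l)%C.
Proof. exact (is_series_scal (V := C_NormedModule) w a l). Qed.

Lemma is_Cseries_unique (a : nat -> C) (l l' : C) :
  is_Cseries a l -> is_Cseries a l' -> l = l'.
Proof.
  apply (filterlim_locally_unique (V := C_R_NormedModule) (F := eventually)).
Qed.

Lemma is_Cseries_incr_1 (a : nat -> C) (l : C) :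
  is_Cseries a l -> is_Cseries (fun j => a (S j)) (l - a 0%nat)%C.
Proof.
  intro H. apply (is_series_incr_1 (V := C_R_NormedModule)).
  evar_last; [exact H |].
  change (l = l - a 0%nat + a 0%nat)%C. ring.
Qed.

Lemma is_Cseries_RtoC (a : nat -> R) (l : R) :
  is_series a l -> is_Cseries (fun j => RtoC (a j)) (RtoC l).
Proof.
  intro H.
  assert (E : forall n, RtoC (sum_n a n) = sum_n (G := C_AbelianMonoid) (fun j => RtoC (a j)) n).
  { induction n as [| n IH]; [now rewrite !sum_O |].
    rewrite !sum_Sn, <- IH. apply RtoC_plus. }
  unfold is_series. apply filterlim_ext with (1 := E).
  apply (filterlim_comp _ _ _ (sum_n a) RtoC _ (locally l)); [exact H |].
  intros P [eps HP]. exists eps. intros y Hy. apply HP. split; [exact Hy |].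
  apply (ball_center (M := R_UniformSpace)).
Qed.

(** * Exponential generating functions *)

Definition egf_term (c : nat -> R) (z : C) (j : nat) : C :=
  (RtoC (c j / INR (fact j)) * z ^ j)%C.

Definition egf (c : nat -> R) (z : C) : C :=
  iota (T := C_R_CompleteNormedModule) (is_Cseries (egf_term c z)).

(** The growth condition is closed under the shift of the coefficients, which is
    how [egf] is differentiated, and it makes the series entire. *)
Definition geom_bounded (c : nat -> R) : Prop := exists A, forall j, Rabs (c j) <= A * 2 ^ j.

Lemma geom_bounded_shift (c : nat -> R) : geom_bounded c -> geom_bounded (fun j => c (S j)).
Proof.
  intros [A H]. exists (2 * A). intro j. specialize (H (S j)). simpl in H. lra.
Qed.

Lemma ex_series_exp (A x : R) : ex_series (fun j => A * (x ^ j / INR (fact j))).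
Proof.
  apply (ex_series_scal_l (V := R_NormedModule) A). exists (exp x).
  apply (is_series_ext) with (2 := is_exp_Reals x). intro j.
  rewrite pow_n_pow. reflexivity.
Qed.

Lemma INR_fact_pos (j : nat) : 0 < INR (fact j).
Proof. apply lt_0_INR, lt_O_fact. Qed.

Lemma INR_le_pow2 (j : nat) : INR (S j) <= 2 ^ j.
Proof.
  induction j as [| j IH]; [simpl; lra |].
  rewrite S_INR in *. rewrite S_INR. pose proof (pos_INR j). simpl pow. lra.
Qed.

Lemma Cmod_egf_term (c : nat -> R) (z : C) (A : R) (j : nat) :
  Rabs (c j) <= A * 2 ^ j ->
  Cmod (egf_term c z j) <= A * ((2 * Cmod z) ^ j / INR (fact j)).
Proof.
  intro H. unfold egf_term. rewrite Cmod_mult, Cmod_R, Cmod_pow, Rpow_mult_distr.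
  pose proof (INR_fact_pos j) as Hf. pose proof (pow_le _ j (Cmod_ge_0 z)).
  unfold Rdiv. rewrite Rabs_mult, Rabs_inv, (Rabs_pos_eq (INR (fact j))) by lra.
  assert (0 <= / INR (fact j)) by (left; now apply Rinv_0_lt_compat).
  replace (A * (2 ^ j * Cmod z ^ j * / INR (fact j)))
    with (A * 2 ^ j * / INR (fact j) * Cmod z ^ j) by ring.
  apply Rmult_le_compat_r; [assumption |].
  now apply Rmult_le_compat_r.
Qed.

Lemma is_Cseries_egf (c : nat -> R) (z : C) :
  geom_bounded c -> is_Cseries (egf_term c z) (egf c z).
Proof.
  intros [A HA].
  assert (Hex : ex_series (V := C_R_NormedModule) (egf_term c z)).
  { apply (ex_series_le (V := C_R_CompleteNormedModule) _
      (fun j => A * ((2 * Cmod z) ^ j / INR (fact j)))).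
    - intro j. rewrite <- Cmod_norm. apply Cmod_egf_term, HA.
    - apply ex_series_exp. }
  destruct Hex as [l Hl].
  replace (egf c z) with l; [exact Hl |]. symmetry.
  apply (iota_filterlim_locally (V := C_R_CompleteNormedModule) (F := eventually) _ l Hl).
Qed.

Lemma Cpow_line (z v : C) (j : nat) (s : R) :
  is_Cderive (fun u => (z + RtoC u * v) ^ (S j))%C s
    (RtoC (INR (S j)) * v * (z + RtoC s * v) ^ j)%C.
Proof.
  induction j as [| j IH].
  - apply (is_derive_ext (V := C_R_NormedModule) (fun u => (z + RtoC u * v)%C)).
    + intro t. symmetry. apply Cpow_1_r.
    + replace (RtoC (INR 1) * v * (z + RtoC s * v) ^ 0)%C with v by (simpl; ring).
      apply is_Cderive_line.
  - evar_last.
    + apply (is_Cderive_mult _ _ _ _ _ (is_Cderive_line z v s) IH).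
    + simpl Cpow. rewrite (S_INR (S j)), RtoC_plus. ring.
Qed.

(** Stated with j r^j instead of j r^(j-1), at the price of 1 <= r, which avoids a
    case distinction at j = 0. *)
Lemma Cmod_pow_minus (a b : C) (r : R) (j : nat) :
  1 <= r -> Cmod a <= r -> Cmod b <= r ->
  Cmod (a ^ j - b ^ j) <= Cmod (a - b) * (INR j * r ^ j).
Proof.
  intros Hr Ha Hb. induction j as [| j IH].
  - simpl Cpow. replace (1 - 1)%C with (RtoC 0) by ring. rewrite Cmod_0. simpl. lra.
  - replace (a ^ S j - b ^ S j)%C with (a * (a ^ j - b ^ j) + (a - b) * b ^ j)%C
      by (simpl; ring).
    apply Rle_trans with (1 := Cmod_triangle _ _).
    rewrite !Cmod_mult, Cmod_pow, S_INR. simpl pow.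
    assert (Hb' : Cmod b ^ j <= r ^ j) by (apply pow_incr; split; [apply Cmod_ge_0 | exact Hb]).
    assert (Hrj : 0 < r ^ j) by (apply pow_lt; lra).
    pose proof (Cmod_ge_0 (a - b)) as H0. pose proof (Cmod_ge_0 a) as Ha0.
    pose proof (Cmod_ge_0 (a ^ j - b ^ j)) as H1.
    assert (P1 : Cmod a * Cmod (a ^ j - b ^ j) <= r * (Cmod (a - b) * (INR j * r ^ j))).
    { apply Rmult_le_compat; assumption. }
    assert (P2 : Cmod (a - b) * Cmod b ^ j <= Cmod (a - b) * (r * r ^ j)).
    { apply Rmult_le_compat_l; [exact H0 | nra]. }
    lra.
Qed.

(** Complex differentiability is only needed along real lines z + u v, as a
    function of the real parameter u; the terms of the shifted series are the
    derivatives of those of index at least 1. *)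
Lemma egf_line_0 (c : nat -> R) (z v : C) : geom_bounded c ->
  is_Cderive (fun u => egf c (z + RtoC u * v)) 0 (v * egf (fun j => c (S j)) z)%C.
Proof.
  intros Hc. pose proof Hc as [A HA].
  set (r := Cmod z + Cmod v + 1).
  assert (Hr : 1 <= r) by (pose proof (Cmod_ge_0 z); pose proof (Cmod_ge_0 v); unfold r; lra).
  set (d := fun j => match j with
    | O => RtoC 0 | S i => (v * egf_term (fun j => c (S j)) z i)%C end).
  assert (Hz0 : (z + RtoC 0 * v = z)%C) by ring.
  apply (is_derive_series (V := C_R_NormedModule)
    (fun j u => egf_term c (z + RtoC u * v) j) d _ _
    (fun j => Cmod v * A * ((4 * r) ^ j / INR (fact j))) 0 (mkposreal 1 Rlt_0_1)).
  - intros [| i].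
    + apply (is_derive_ext (V := C_R_NormedModule) (fun _ => RtoC (c 0%nat))).
      * intro t. unfold egf_term. simpl. rewrite Rdiv_1_r. symmetry. apply Cmult_1_r.
      * apply (is_derive_const (V := C_R_NormedModule)).
    + unfold d, egf_term.
      evar_last.
      * apply is_Cderive_mult; [apply (is_derive_const (V := C_R_NormedModule)) | apply Cpow_line].
      * rewrite Hz0. change (zero : C_R_NormedModule) with (RtoC 0).
        change (fact (S i)) with (S i * fact i)%nat. rewrite mult_INR.
        assert (INR (S i) <> 0) by (apply not_0_INR; lia).
        pose proof (INR_fact_pos i).
        replace (c (S i) / INR (fact i)) with (c (S i) / (INR (S i) * INR (fact i)) * INR (S i))
          by (field; lra).
        rewrite (RtoC_mult _ (INR (S i))). ring.
  - intros j y Hy. simpl in Hy. rewrite Rminus_0_r in *.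
    change (norm (V := C_R_NormedModule) (minus (egf_term c (z + RtoC y * v) j : C_R_NormedModule)
       (egf_term c (z + 0 * v) j))) with
       (norm (V := C_R_NormedModule) (egf_term c (z + RtoC y * v) j - egf_term c (z + 0 * v) j)%C).
    rewrite <- Cmod_norm, Hz0. unfold egf_term.
    replace (RtoC (c j / INR (fact j)) * (z + RtoC y * v) ^ j - RtoC (c j / INR (fact j)) * z ^ j)%C
      with (RtoC (c j / INR (fact j)) * ((z + RtoC y * v) ^ j - z ^ j))%C by ring.
    rewrite Cmod_mult, Cmod_R.
    assert (H := Cmod_pow_minus (z + RtoC y * v) z r j Hr).
    replace (z + RtoC y * v - z)%C with (RtoC y * v)%C in H by ring.
    rewrite Cmod_mult, Cmod_R in H.
    assert (Hyv : Rabs y * Cmod v <= Cmod v).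
    { pose proof (Cmod_ge_0 v). nra. }
    assert (H1 : Cmod (z + RtoC y * v) <= r).
    { apply Rle_trans with (1 := Cmod_triangle _ _). rewrite Cmod_mult, Cmod_R. unfold r. lra. }
    assert (H2 : Cmod z <= r) by (pose proof (Cmod_ge_0 v); unfold r; lra).
    specialize (H H1 H2).
    pose proof (INR_fact_pos j) as Hf.
    assert (Hj : INR j <= 2 ^ j).
    { apply Rle_trans with (2 := INR_le_pow2 j). rewrite S_INR. lra. }
    unfold Rdiv. rewrite Rabs_mult, Rabs_inv, (Rabs_pos_eq (INR (fact j))) by lra.
    assert (Hi : 0 < / INR (fact j)) by now apply Rinv_0_lt_compat.
    assert (Hrj : 0 < r ^ j) by (apply pow_lt; lra).
    replace (4 * r) with (2 * 2 * r) by ring. rewrite !Rpow_mult_distr.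
    apply Rle_trans with (A * 2 ^ j * / INR (fact j) * (Rabs y * Cmod v * (2 ^ j * r ^ j))).
    + apply Rmult_le_compat.
      * apply Rmult_le_pos; [apply Rabs_pos | lra].
      * apply Cmod_ge_0.
      * apply Rmult_le_compat_r; [lra | apply HA].
      * apply Rle_trans with (1 := H). apply Rmult_le_compat_l.
        -- apply Rmult_le_pos; [apply Rabs_pos | apply Cmod_ge_0].
        -- apply Rmult_le_compat_r; lra.
    + right. ring.
  - apply ex_series_exp.
  - intros y _. apply is_Cseries_egf, Hc.
  - apply (is_series_decr_1 (V := C_R_NormedModule)).
    evar_last.
    + apply (is_Cseries_mult_l v). apply is_Cseries_egf, geom_bounded_shift, Hc.
    + change (v * egf (fun j => c (S j)) z = v * egf (fun j => c (S j)) z + - 0)%C. ring.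
Qed.

Lemma egf_line (c : nat -> R) (z v : C) (s : R) : geom_bounded c ->
  is_Cderive (fun u => egf c (z + RtoC u * v)) s
    (v * egf (fun j => c (S j)) (z + RtoC s * v))%C.
Proof.
  intro Hc. pose proof (egf_line_0 c (z + RtoC s * v) v Hc) as H.
  apply (is_derive_ext (V := C_R_NormedModule)
    (fun u => egf c (z + RtoC s * v + RtoC (u - s) * v))).
  { intro t. f_equal. rewrite RtoC_minus. ring. }
  rewrite <- (Rminus_diag s) in H at 1.
  evar_last.
  - apply (is_derive_comp (V := C_R_NormedModule)
      (fun u => egf c (z + RtoC s * v + RtoC u * v)) (fun u => u - s) s _ 1 H).
    auto_derive; [exact I | ring].
  - apply (scal_one (V := C_R_NormedModule)).
Qed.

Lemma egf_0 (c : nat -> R) : geom_bounded c -> egf c 0 = RtoC (c 0%nat).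
Proof.
  intro Hc. apply is_Cseries_unique with (1 := is_Cseries_egf c 0 Hc).
  apply (is_series_decr_1 (V := C_R_NormedModule)).
  apply (is_series_ext (V := C_R_NormedModule) (fun _ => zero)).
  - intro j. unfold egf_term. simpl. change (RtoC 0 = RtoC (c (S j) / INR (fact j + j * fact j)) * (0 * 0 ^ j))%C. ring.
  - replace (plus _ _) with (zero : C_R_NormedModule).
    + apply filterlim_ext with (fun _ : nat => (zero : C_R_NormedModule)).
      * intro n. symmetry. apply (sum_n_m_const_zero (G := C_R_NormedModule)).
      * apply filterlim_const.
    + unfold egf_term. simpl.
      change (RtoC 0 = RtoC (c 0%nat) + - (RtoC (c 0%nat / 1) * 1))%C.
      rewrite Rdiv_1_r. ring.
Qed.

Lemma geom_bounded_1 : geom_bounded (fun _ => 1).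
Proof.
  exists 1. intro j. rewrite Rabs_R1, Rmult_1_l. apply pow_R1_Rle. lra.
Qed.

(** The product of e^(-u z) with the series at u z has derivative 0 in u. *)
Lemma egf_1 (z : C) : egf (fun _ => 1) z = Cexp z.
Proof.
  set (Q := fun u : R => (Cexp (0 + RtoC u * - z) * egf (fun _ => 1%R) (0 + RtoC u * z))%C).
  assert (HQ : forall s, is_Cderive Q s zero).
  { intro s. unfold Q. evar_last.
    - apply is_Cderive_mult; [apply Cexp_line | apply egf_line, geom_bounded_1].
    - simpl. change (zero : C_R_NormedModule) with (RtoC 0). ring. }
  assert (E : Q 0 = Q 1).
  { apply (eq_is_derive (V := C_R_NormedModule) Q 0 1); [intros; apply HQ | lra]. }
  unfold Q in E.
  replace (0 + 0 * - z)%C with (RtoC 0) in E by ring.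
  replace (0 + 0 * z)%C with (RtoC 0) in E by ring.
  replace (0 + 1 * - z)%C with (- z)%C in E by ring.
  replace (0 + 1 * z)%C with z in E by ring.
  rewrite Cexp_0, egf_0 in E by apply geom_bounded_1.
  replace (egf (fun _ : nat => 1) z) with (Cexp z * (Cexp (- z) * egf (fun _ : nat => 1%R) z))%C.
  - rewrite <- E. ring.
  - rewrite Cmult_assoc, (Cmult_comm (Cexp z)), Cexp_opp_mult. ring.
Qed.

(** * The entire function Ein z - gamma *)

Definition psi_coef (j : nat) : R := digamma (INR (S j)).

Lemma psi_coef_S (j : nat) : psi_coef (S j) = psi_coef j + / INR (S j).
Proof.
  unfold psi_coef. rewrite (S_INR (S j)), digamma_succ by (apply lt_0_INR; lia).
  unfold Rdiv. ring.
Qed.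

Lemma geom_bounded_psi_coef : geom_bounded psi_coef.
Proof.
  exists 1. intro j. rewrite Rmult_1_l.
  assert (Hj : 1 <= INR (S j)) by (apply (le_INR 1); lia).
  destruct (digamma_bounds (INR (S j)) ltac:(lra)) as [H1 H2].
  assert (H3 : ln 1 <= ln (INR (S j))) by (apply ln_le; lra). rewrite ln_1 in H3.
  assert (H4 := ln_le_tangent (INR (S j)) 1 ltac:(lra) ltac:(lra)). rewrite ln_1 in H4.
  assert (H5 : / INR (S j) <= / 1) by (apply Rinv_le_contravar; lra).
  pose proof (INR_le_pow2 j). unfold psi_coef. apply Rabs_le. lra.
Qed.

Lemma geom_bounded_inv : geom_bounded (fun j => / INR (S j)).
Proof.
  exists 1. intro j. rewrite Rmult_1_l.
  assert (Hj : 1 <= INR (S j)) by (apply (le_INR 1); lia).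
  assert (0 < / INR (S j)) by (apply Rinv_0_lt_compat; lra).
  assert (/ INR (S j) <= / 1) by (apply Rinv_le_contravar; lra).
  pose proof (INR_le_pow2 j). rewrite Rabs_pos_eq; lra.
Qed.

(** The series of (e^z - 1) / z, multiplied by z so as to hold at 0 as well. *)
Lemma mult_egf_inv (z : C) : (z * egf (fun j => / INR (S j))%R z)%C = (Cexp z - 1)%C.
Proof.
  apply is_Cseries_unique with
    (1 := is_Cseries_mult_l z _ _ (is_Cseries_egf _ z geom_bounded_inv)).
  apply (is_series_ext (V := C_R_NormedModule) (fun j => egf_term (fun _ => 1%R) z (S j))).
  - intro j. unfold egf_term. change (fact (S j)) with (S j * fact j)%nat.
    rewrite mult_INR. pose proof (INR_fact_pos j).
    assert (INR (S j) <> 0) by (apply not_0_INR; lia).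
    replace (1 / (INR (S j) * INR (fact j))) with (/ INR (S j) / INR (fact j)) by (field; lra).
    simpl. ring.
  - replace (Cexp z - 1)%C with (egf (fun _ => 1%R) z - egf_term (fun _ => 1%R) z 0)%C.
    + apply is_Cseries_incr_1, is_Cseries_egf, geom_bounded_1.
    + rewrite egf_1. unfold egf_term. simpl. rewrite Rdiv_1_r. ring.
Qed.

Lemma egf_psi_coef_shift (z : C) :
  egf (fun j => psi_coef (S j)) z = (egf psi_coef z + egf (fun j => / INR (S j))%R z)%C.
Proof.
  apply is_Cseries_unique with (1 := is_Cseries_egf _ z (geom_bounded_shift _ geom_bounded_psi_coef)).
  apply (is_series_ext (V := C_R_NormedModule)
    (fun j => plus (egf_term psi_coef z j) (egf_term (fun j => / INR (S j)) z j))).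
  - intro j. unfold egf_term. rewrite psi_coef_S. unfold Rdiv.
    rewrite Rmult_plus_distr_r, RtoC_plus.
    match goal with |- @eq _ (plus ?b ?c) ?a => change ((b + c)%C = a :> C) end. ring.
  - apply (is_series_plus (V := C_R_NormedModule)); apply is_Cseries_egf;
      [apply geom_bounded_psi_coef | apply geom_bounded_inv].
Qed.

(** This is Ein z - gamma: its value at 0 is psi(1) = - gamma and, by
    [Ein_minus_gamma_line], its derivative is (1 - e^(-z)) / z. *)
Definition Ein_minus_gamma (z : C) : C := (Cexp (- z) * egf psi_coef z)%C.

(** The two contributions of the product rule cancel except for the difference
    between F' and F, which the recurrence of psi identifies with
    (e^w - 1) / w. *)
Lemma Ein_minus_gamma_line (z v : C) (s : R) : (z + RtoC s * v <> 0)%C ->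
  is_Cderive (fun u => Ein_minus_gamma (z + RtoC u * v)) s
    (v * ((1 - Cexp (- (z + RtoC s * v))) / (z + RtoC s * v)))%C.
Proof.
  intro Hw. set (w := (z + RtoC s * v)%C) in *.
  apply (is_derive_ext (V := C_R_NormedModule)
    (fun u => (Cexp (- z + RtoC u * - v) * egf psi_coef (z + RtoC u * v))%C)).
  { intro t. unfold Ein_minus_gamma. do 2 f_equal. ring. }
  evar_last.
  - apply is_Cderive_mult; [apply Cexp_line | apply egf_line, geom_bounded_psi_coef].
  - fold w. rewrite egf_psi_coef_shift.
    replace (- z + RtoC s * - v)%C with (- w)%C by (unfold w; ring).
    assert (E : egf (fun j => / INR (S j))%R w = ((Cexp w - 1) / w)%C).
    { rewrite <- mult_egf_inv. field. exact Hw. }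
    rewrite E.
    replace (v * ((1 - Cexp (- w)) / w))%C
      with (v * ((Cexp (- w) * Cexp w - Cexp (- w)) / w))%C
      by (rewrite Cexp_opp_mult; reflexivity).
    fold w. field. exact Hw.
Qed.

Lemma is_series_le (a b : nat -> R) (la lb : R) :
  (forall j, a j <= b j) -> is_series a la -> is_series b lb -> la <= lb.
Proof.
  intros H Ha Hb.
  apply (is_lim_seq_le (sum_n a) (sum_n b) la lb); [| exact Ha | exact Hb].
  intro n. apply sum_n_m_le, H.
Qed.

(** With the next two lemmas: total mass, mean of J, and mean of 1/(J+1) for the
    Poisson weights of parameter s, before normalisation by e^(-s). *)
Lemma is_series_poisson (s : R) : is_series (fun j => s ^ j / INR (fact j)) (exp s).
Proof.
  apply is_series_ext with (2 := is_exp_Reals s). intro j. rewrite pow_n_pow. reflexivity.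
Qed.

Lemma is_series_poisson_mean (s : R) :
  is_series (fun j => s ^ j / INR (fact j) * INR j) (s * exp s).
Proof.
  apply is_series_decr_1.
  evar_last.
  - apply (is_series_ext (fun j => scal s (s ^ j / INR (fact j)))).
    + intro j. change (fact (S j)) with (S j * fact j)%nat. rewrite mult_INR.
      pose proof (INR_fact_pos j). assert (INR (S j) <> 0) by (apply not_0_INR; lia).
      change (s * (s ^ j / INR (fact j)) = s * s ^ j / (INR (S j) * INR (fact j)) * INR (S j)).
      field. lra.
    + apply (is_series_scal (V := R_NormedModule)), is_series_poisson.
  - simpl. change (s * exp s = s * exp s + - (1 / 1 * 0)). field.
Qed.

Lemma is_series_poisson_inv (s : R) : 0 < s ->
  is_series (fun j => s ^ j / INR (fact j) * / INR (S j)) ((exp s - 1) / s).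
Proof.
  intro Hs.
  assert (H : is_series (fun j => s ^ S j / INR (fact (S j))) (exp s - 1)).
  { apply (is_series_incr_1 (fun j => s ^ j / INR (fact j))).
    evar_last; [apply is_series_poisson |].
    simpl. change (exp s = exp s - 1 + 1 / 1). field. }
  apply (is_series_scal (V := R_NormedModule) (/ s)) in H.
  evar_last.
  - apply is_series_ext with (2 := H). intro j.
    change (fact (S j)) with (S j * fact j)%nat. rewrite mult_INR.
    pose proof (INR_fact_pos j). assert (INR (S j) <> 0) by (apply not_0_INR; lia).
    change (/ s * (s * s ^ j / (INR (S j) * INR (fact j)))
      = s ^ j / INR (fact j) * / INR (S j)).
    field. lra.
  - change (/ s * (exp s - 1) = (exp s - 1) / s). field. lra.
Qed.

(** Jensen's inequality for the Poisson mean of psi(J+1).  Above, psi(J+1) is at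
    most ln (J+1), which is replaced by its tangent at the mean s + 1; below,
    ln (J+1) is at least ln s + 1 - s/(J+1), whose mean is explicit. *)
Lemma Ein_minus_gamma_real_bounds (s : R) : 0 < s ->
  exists e, Ein_minus_gamma (RtoC s) = RtoC e /\ ln s - 1 / s <= e <= ln (s + 1).
Proof.
  intro Hs.
  assert (Hex : ex_series (fun j => psi_coef j / INR (fact j) * s ^ j)).
  { destruct geom_bounded_psi_coef as [A HA].
    apply (ex_series_le (V := R_CompleteNormedModule) _
      (fun j => A * ((2 * Cmod (RtoC s)) ^ j / INR (fact j)))).
    - intro j. apply Rle_trans with (2 := Cmod_egf_term psi_coef (RtoC s) A j (HA j)).
      unfold egf_term. rewrite <- RtoC_pow, <- RtoC_mult, Cmod_R. apply Rle_refl.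
    - apply ex_series_exp. }
  destruct Hex as [l Hl].
  assert (El : egf psi_coef (RtoC s) = RtoC l).
  { apply is_Cseries_unique with (1 := is_Cseries_egf _ _ geom_bounded_psi_coef).
    apply (is_series_ext (V := C_R_NormedModule) (fun j => RtoC (psi_coef j / INR (fact j) * s ^ j))).
    - intro j. unfold egf_term. now rewrite RtoC_mult, RtoC_pow.
    - now apply is_Cseries_RtoC. }
  exists (exp (- s) * l). split.
  - unfold Ein_minus_gamma. rewrite El, <- RtoC_opp, Cexp_RtoC, RtoC_mult. reflexivity.
  - assert (Hw : forall j, 0 < s ^ j / INR (fact j)).
    { intro j. apply Rdiv_lt_0_compat; [now apply pow_lt | apply INR_fact_pos]. }
    assert (Hdg : forall j, ln (INR (S j)) - 1 / INR (S j) <= psi_coef j <= ln (INR (S j))).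
    { intro j. apply digamma_bounds. apply lt_0_INR. lia. }
    assert (Hu : l <= exp s * ln (s + 1)).
    { apply (is_series_le (fun j => psi_coef j / INR (fact j) * s ^ j)
        (fun j => plus (scal (ln (s + 1) - s / (s + 1)) (s ^ j / INR (fact j)))
          (scal (/ (s + 1)) (s ^ j / INR (fact j) * INR j))) l).
      - intro j. unfold scal, plus; simpl. unfold mult; simpl.
        replace (psi_coef j / INR (fact j) * s ^ j) with (s ^ j / INR (fact j) * psi_coef j)
          by (unfold Rdiv; ring).
        replace ((ln (s + 1) - s / (s + 1)) * (s ^ j / INR (fact j)) +
          / (s + 1) * (s ^ j / INR (fact j) * INR j))
          with (s ^ j / INR (fact j) * (ln (s + 1) + (INR (S j) - (s + 1)) / (s + 1))).
        + apply Rmult_le_compat_l; [left; apply Hw |].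
          apply Rle_trans with (1 := proj2 (Hdg j)).
          apply ln_le_tangent; [apply lt_0_INR; lia | lra].
        + rewrite S_INR. pose proof (INR_fact_pos j). field. lra.
      - exact Hl.
      - evar_last.
        + apply (is_series_plus (V := R_NormedModule));
            apply (is_series_scal (V := R_NormedModule));
            [apply is_series_poisson | apply is_series_poisson_mean].
        + unfold scal, plus; simpl. unfold mult; simpl. field. lra. }
    assert (Hlo : exp s * (ln s - 1 / s) <= l).
    { apply Rle_trans with ((ln s + 1) * exp s + - (s + 1) * ((exp s - 1) / s)).
      - replace ((ln s + 1) * exp s + - (s + 1) * ((exp s - 1) / s))
          with (exp s * (ln s - 1 / s) + (s + 1) / s) by (field; lra).
        assert (0 < (s + 1) / s) by (apply Rdiv_lt_0_compat; lra). lra.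
      - apply (is_series_le (fun j => plus (scal (ln s + 1) (s ^ j / INR (fact j)))
          (scal (- (s + 1)) (s ^ j / INR (fact j) * / INR (S j))))
          (fun j => psi_coef j / INR (fact j) * s ^ j)).
        + intro j. unfold scal, plus; simpl. unfold mult; simpl.
          replace (psi_coef j / INR (fact j) * s ^ j) with (s ^ j / INR (fact j) * psi_coef j)
            by (unfold Rdiv; ring).
          change (match j with 0%nat => 1 | S _ => INR j + 1 end) with (INR (S j)).
          replace ((ln s + 1) * (s ^ j / INR (fact j)) +
            - (s + 1) * (s ^ j / INR (fact j) * / INR (S j)))
            with (s ^ j / INR (fact j) * (ln s + 1 - s / INR (S j) - 1 / INR (S j)))
            by (unfold Rdiv; ring).
          apply Rmult_le_compat_l; [left; apply Hw |].
          apply Rle_trans with (2 := proj1 (Hdg j)).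
          assert (HS : 0 < INR (S j)) by (apply lt_0_INR; lia).
          assert (H := ln_le_tangent s (INR (S j)) Hs HS).
          replace ((s - INR (S j)) / INR (S j)) with (s / INR (S j) - 1) in H by (field; lra).
          lra.
        + apply (is_series_plus (V := R_NormedModule));
            apply (is_series_scal (V := R_NormedModule));
            [apply is_series_poisson | now apply is_series_poisson_inv].
        + exact Hl. }
    pose proof (exp_pos (- s)) as He.
    assert (Ee : exp (- s) * exp s = 1) by (rewrite <- exp_plus, Rplus_opp_l; apply exp_0).
    split.
    + replace (ln s - 1 / s) with (exp (- s) * (exp s * (ln s - 1 / s)))
        by (rewrite <- Rmult_assoc, Ee; ring).
      apply Rmult_le_compat_l; lra.
    + replace (ln (s + 1)) with (exp (- s) * (exp s * ln (s + 1)))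
        by (rewrite <- Rmult_assoc, Ee; ring).
      apply Rmult_le_compat_l; lra.
Qed.

Lemma Re_le_Cmod (z : C) : Rabs (Re z) <= Cmod z.
Proof. apply Rle_trans with (2 := Rmax_Cmod z). apply Rmax_l. Qed.

Lemma Im_le_Cmod (z : C) : Rabs (Im z) <= Cmod z.
Proof. apply Rle_trans with (2 := Rmax_Cmod z). apply Rmax_r. Qed.

Lemma Cmod_le_parts (z : C) : Cmod z <= Rabs (Re z) + Rabs (Im z).
Proof.
  replace z with (RtoC (Re z) + RtoC (Im z) * Ci)%C at 1.
  - apply Rle_trans with (1 := Cmod_triangle _ _).
    rewrite Cmod_mult, Cmod_Ci, !Cmod_R. lra.
  - destruct z as [a b]. apply injective_projections; simpl; ring.
Qed.

(** The factor 2 comes from treating the two components separately. *)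
Lemma Cbounded_variation (f df : R -> C) (D x y : R) :
  (forall t, is_Cderive f t (df t)) -> (forall t, Cmod (df t) <= D) ->
  Cmod (f y - f x) <= 2 * (D * Rabs (y - x)).
Proof.
  intros Hd HD.
  apply Rle_trans with (1 := Cmod_le_parts _).
  assert (H1 : Rabs (Re (f y) - Re (f x)) <= D * Rabs (y - x)).
  { apply (bounded_variation (fun t => Re (f t)) (fun t => Re (df t))). intros t _. split.
    - apply (is_Cderive_iff f t (df t)), Hd.
    - apply Rle_trans with (1 := Re_le_Cmod _), HD. }
  assert (H2 : Rabs (Im (f y) - Im (f x)) <= D * Rabs (y - x)).
  { apply (bounded_variation (fun t => Im (f t)) (fun t => Im (df t))). intros t _. split.
    - apply (is_Cderive_iff f t (df t)), Hd.
    - apply Rle_trans with (1 := Im_le_Cmod _), HD. }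
  change (Rabs (Re (f y) - Re (f x)) + Rabs (Im (f y) - Im (f x)) <= 2 * (D * Rabs (y - x))).
  lra.
Qed.

(** The derivative on the line Re = s is at most (1 + e^(-s)) / s <= 2 / s. *)
Lemma Ein_minus_gamma_vertical (s b : R) : 0 < s ->
  Cmod (Ein_minus_gamma (s, b) - Ein_minus_gamma (RtoC s)) <= 4 * Rabs b / s.
Proof.
  intro Hs.
  assert (Hre : forall t, Re (RtoC s + RtoC t * Ci)%C = s) by (intro t; simpl; ring).
  assert (Hge : forall t, s <= Cmod (RtoC s + RtoC t * Ci)%C).
  { intro t. rewrite <- (Hre t) at 1. apply Rle_trans with (2 := Re_le_Cmod _).
    apply Rle_abs. }
  assert (Hne : forall t, (RtoC s + RtoC t * Ci)%C <> 0).
  { intros t H. specialize (Hge t). rewrite H, Cmod_0 in Hge. lra. }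
  replace (s, b) with (RtoC s + RtoC b * Ci)%C
    by (apply injective_projections; simpl; ring).
  replace (Ein_minus_gamma (RtoC s)) with (Ein_minus_gamma (RtoC s + RtoC 0 * Ci)%C) by (f_equal; ring).
  replace (4 * Rabs b / s) with (2 * (2 / s * Rabs (b - 0)))
    by (rewrite Rminus_0_r; field; lra).
  apply (Cbounded_variation (fun t => Ein_minus_gamma (RtoC s + RtoC t * Ci)%C)
    (fun t => Ci * ((1 - Cexp (- (RtoC s + RtoC t * Ci))) / (RtoC s + RtoC t * Ci)))%C
    (2 / s) 0 b).
  - intro t. apply Ein_minus_gamma_line, Hne.
  - intro t. cbv beta. rewrite Cmod_mult, Cmod_Ci, Rmult_1_l, Cmod_div by apply Hne.
    assert (Hn : Cmod (1 - Cexp (- (RtoC s + RtoC t * Ci))) <= 2).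
    { apply Rle_trans with (1 := Cmod_triangle _ _). rewrite Cmod_opp, Cmod_1, Cmod_Cexp.
      replace (Re (- (RtoC s + RtoC t * Ci))) with (- s) by (simpl; ring).
      assert (exp (- s) < exp 0) by (apply exp_increasing; lra). rewrite exp_0 in *. lra. }
    specialize (Hge t). unfold Rdiv. apply Rmult_le_compat.
    + apply Cmod_ge_0.
    + left. apply Rinv_0_lt_compat. lra.
    + exact Hn.
    + apply Rinv_le_contravar; lra.
Qed.

(** * The principal logarithm *)

(** The branch of [Carg] is tested through the sign of the sine; the four lemmas
    below express it through atan on regions that together cover the plane
    without 0. *)
Lemma Carg_polar (rho theta : R) : 0 < rho -> - PI < theta <= PI ->
  Carg (rho * cos theta, rho * sin theta) = theta.
Proof.
  intros Hr Ht. unfold Carg.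
  assert (Hm : Cmod (rho * cos theta, rho * sin theta) = rho).
  { unfold Cmod. simpl.
    replace (rho * cos theta * (rho * cos theta * 1) + rho * sin theta * (rho * sin theta * 1))
      with (rho * rho).
    - apply sqrt_square. lra.
    - pose proof (sin2_cos2 theta) as H. unfold Rsqr in H. nra. }
  rewrite Hm. simpl.
  replace (rho * cos theta / rho) with (cos theta) by (field; lra).
  destruct (Rle_lt_dec 0 theta) as [H0 | H0].
  - assert (0 <= sin theta) by (apply sin_ge_0; lra).
    destruct (Rle_dec 0 (rho * sin theta)) as [_ | Hn]; [apply acos_cos; lra |].
    exfalso. apply Hn. apply Rmult_le_pos; lra.
  - assert (Hs : sin theta < 0) by (apply sin_lt_0_var; lra).
    destruct (Rle_dec 0 (rho * sin theta)) as [Hp | _]; [exfalso; nra |].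
    rewrite <- cos_neg, acos_cos; lra.
Qed.

Lemma sqrt_1_plus_pos (x : R) : 0 < sqrt (1 + x²).
Proof. apply sqrt_lt_R0. pose proof (Rle_0_sqr x). lra. Qed.

Lemma Carg_Re_pos (a b : R) : 0 < a -> Carg (a, b) = atan (b / a).
Proof.
  intro Ha. pose proof (sqrt_1_plus_pos (b / a)) as Hq. pose proof (atan_bound (b / a)).
  rewrite <- (Carg_polar (a * sqrt (1 + (b / a)²)) (atan (b / a))).
  - rewrite cos_atan, sin_atan. f_equal. f_equal; field; lra.
  - now apply Rmult_lt_0_compat.
  - lra.
Qed.

Lemma Carg_Im_pos (a b : R) : 0 < b -> Carg (a, b) = PI / 2 - atan (a / b).
Proof.
  intro Hb. pose proof (sqrt_1_plus_pos (a / b)) as Hq. pose proof (atan_bound (a / b)).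
  rewrite <- (Carg_polar (b * sqrt (1 + (a / b)²)) (PI / 2 - atan (a / b))).
  - rewrite cos_shift, sin_shift, cos_atan, sin_atan. f_equal. f_equal; field; lra.
  - now apply Rmult_lt_0_compat.
  - lra.
Qed.

Lemma Carg_Im_neg (a b : R) : b < 0 -> Carg (a, b) = - (PI / 2) - atan (a / b).
Proof.
  intro Hb. pose proof (sqrt_1_plus_pos (a / b)) as Hq. pose proof (atan_bound (a / b)).
  pose proof PI_RGT_0.
  rewrite <- (Carg_polar (- b * sqrt (1 + (a / b)²)) (- (PI / 2) - atan (a / b))).
  - replace (- (PI / 2) - atan (a / b)) with (- (PI / 2 - - atan (a / b))) by ring.
    rewrite cos_neg, sin_neg, cos_shift, sin_shift, cos_neg, sin_neg, cos_atan, sin_atan.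
    f_equal. f_equal; field; lra.
  - apply Rmult_lt_0_compat; lra.
  - lra.
Qed.

(** The closed condition 0 <= b includes the cut, so that this formula exhibits
    the continuity of the argument from above. *)
Lemma Carg_second_quadrant (a b : R) : a < 0 -> 0 <= b -> Carg (a, b) = PI + atan (b / a).
Proof.
  intros Ha Hb. pose proof (sqrt_1_plus_pos (b / a)) as Hq. pose proof (atan_bound (b / a)).
  pose proof PI_RGT_0.
  assert (Hn : atan (b / a) <= 0).
  { rewrite <- atan_0. destruct Hb as [Hb | <-].
    - left. apply atan_increasing.
      replace (b / a) with (- (b / - a)) by (field; lra).
      assert (0 < b / - a) by (apply Rdiv_lt_0_compat; lra). lra.
    - right. f_equal. unfold Rdiv. ring. }
  rewrite <- (Carg_polar (- a * sqrt (1 + (b / a)²)) (PI + atan (b / a))).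
  - rewrite (Rplus_comm PI), neg_cos, neg_sin, cos_atan, sin_atan.
    f_equal. f_equal; field; lra.
  - apply Rmult_lt_0_compat; lra.
  - lra.
Qed.

(** The complement of the cut, described so that it is visibly stable under
    translation to the right. *)
Definition slit_plane (z : C) : Prop := 0 < Re z \/ Im z <> 0.

Lemma slit_plane_plane_neq_0 (z : C) : slit_plane z -> z <> 0.
Proof. intros [H | H] E; rewrite E in H; simpl in H; lra. Qed.

Lemma slit_plane_plane_plus (z : C) (s : R) : slit_plane z -> 0 <= s -> slit_plane (z + RtoC s).
Proof.
  intros [H | H] Hs; [left | right]; simpl; unfold Re, Im in *; simpl; lra.
Qed.

Lemma sum_sqr_pos (a b : R) : 0 < a \/ b <> 0 -> 0 < a * a + b * b.
Proof. intros [H | H]; nra. Qed.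

Lemma Cmod_eq_sqrt (a b : R) : Cmod (a, b) = sqrt (a * a + b * b).
Proof. unfold Cmod. simpl. f_equal. ring. Qed.

(** Off the real axis one atan formula holds on the whole horizontal line, and on
    the positive half axis the argument is locally constant. *)
Lemma Carg_horizontal (a b s : R) : slit_plane (a + s, b) ->
  is_derive (fun u => Carg (a + u, b)) s (- b / ((a + s) * (a + s) + b * b)).
Proof.
  intro Hz. simpl in Hz.
  assert (Hp : 0 < (a + s) * (a + s) + b * b) by (apply sum_sqr_pos; exact Hz).
  destruct (Rtotal_order b 0) as [Hb | [Hb | Hb]].
  - apply (is_derive_ext (fun u => - (PI / 2) - atan ((a + u) / b))).
    + intro u. symmetry. now apply Carg_Im_neg.
    + auto_derive; [lra |]. unfold Rsqr. field. repeat split; try lra.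
  - subst b. destruct Hz as [Hz | Hz]; [simpl in Hz | exfalso; now apply Hz].
    apply (is_derive_ext_loc (fun _ => 0)).
    + exists (mkposreal _ Hz). intros u Hu. change (Rabs (u - s) < a + s) in Hu.
      apply Rabs_def2 in Hu. rewrite Carg_Re_pos by lra.
      unfold Rdiv. now rewrite Rmult_0_l, atan_0.
    + evar_last; [apply is_derive_const |].
      change (0 = - 0 / ((a + s) * (a + s) + 0 * 0)). unfold Rdiv. ring.
  - apply (is_derive_ext (fun u => PI / 2 - atan ((a + u) / b))).
    + intro u. symmetry. now apply Carg_Im_pos.
    + auto_derive; [lra |]. unfold Rsqr. field. repeat split; try lra.
Qed.

Lemma Cln_horizontal (z : C) (s : R) : slit_plane (z + RtoC s) ->
  is_Cderive (fun u => Cln (z + RtoC u)) s (/ (z + RtoC s))%C.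
Proof.
  destruct z as [a b]. intro Hz.
  apply (is_derive_ext (V := C_R_NormedModule)
    (fun u => (ln (sqrt ((a + u) * (a + u) + b * b)), Carg (a + u, b)))).
  { intro u. rewrite <- Cmod_eq_sqrt. unfold Cln, Cplus. simpl. now rewrite Rplus_0_r. }
  replace ((a, b) + RtoC s)%C with (a + s, b) in *
    by (unfold Cplus; simpl; now rewrite Rplus_0_r).
  assert (Hp : 0 < (a + s) * (a + s) + b * b) by (apply sum_sqr_pos; exact Hz).
  apply is_Cderive_iff. simpl. split.
  - assert (Hq : 0 < sqrt ((a + s) * (a + s) + b * b)) by now apply sqrt_lt_R0.
    auto_derive; [repeat split; lra |].
    assert (E : sqrt ((a + s) * (a + s) + b * b) * sqrt ((a + s) * (a + s) + b * b)
      = (a + s) * (a + s) + b * b) by (apply sqrt_sqrt; lra).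
    replace ((1 * (a + s) + (a + s) * 1) * / (2 * sqrt ((a + s) * (a + s) + b * b)) *
      / sqrt ((a + s) * (a + s) + b * b))
      with ((a + s) / (sqrt ((a + s) * (a + s) + b * b) * sqrt ((a + s) * (a + s) + b * b)))
      by (field; lra).
    rewrite E. rewrite !Rmult_1_r. reflexivity.
  - rewrite !Rmult_1_r. now apply Carg_horizontal.
Qed.

(** Existence of the derivative is what the continuity of the integrand of E_1
    along the ray asks for. *)
Lemma Cinv_horizontal (z : C) (s : R) : slit_plane (z + RtoC s) ->
  exists d, is_Cderive (fun u => / (z + RtoC u))%C s d.
Proof.
  destruct z as [a b]. intro Hz.
  assert (Hz' : 0 < a + s \/ b <> 0).
  { destruct Hz as [H | H]; [left | right]; unfold Re, Im in H; simpl in H; lra. }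
  pose proof (sum_sqr_pos _ _ Hz') as Hp.
  assert (H1 : ex_derive (fun u => Re (/ ((a, b) + RtoC u))) s).
  { simpl. auto_derive. lra. }
  assert (H2 : ex_derive (fun u => Im (/ ((a, b) + RtoC u))) s).
  { simpl. auto_derive. lra. }
  destruct H1 as [d1 H1], H2 as [d2 H2]. exists (d1, d2).
  apply is_Cderive_iff. split; assumption.
Qed.

Lemma Cln_minus_Ein_horizontal (z : C) (s : R) : slit_plane (z + RtoC s) ->
  is_Cderive (fun u => Cln (z + RtoC u) - Ein_minus_gamma (z + RtoC u))%C s
    (Cexp (- (z + RtoC s)) / (z + RtoC s))%C.
Proof.
  intro Hz. pose proof (slit_plane_plane_neq_0 _ Hz) as Hn.
  evar_last.
  - apply (is_derive_minus (V := C_R_NormedModule)); [now apply Cln_horizontal |].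
    apply (is_derive_ext (V := C_R_NormedModule) (fun u => Ein_minus_gamma (z + RtoC u * 1)%C)).
    { intro t. f_equal. ring. }
    apply Ein_minus_gamma_line. replace (z + RtoC s * 1)%C with (z + RtoC s)%C by ring. exact Hn.
  - match goal with |- @eq _ (minus ?a ?b) ?c => change (a - b = c :> C)%C end.
    replace (z + RtoC s * 1)%C with (z + RtoC s)%C by ring. field. exact Hn.
Qed.

Lemma filterlim_C_0 {T : Type} (F : (T -> Prop) -> Prop) (FF : Filter F)
  (f : T -> C) (g : T -> R) :
  F (fun t => Cmod (f t) <= g t) -> filterlim g F (locally 0) ->
  filterlim f F (locally (RtoC 0)).
Proof.
  intros Hle Hg P [eps HP].
  specialize (Hg (ball 0 eps) (locally_ball _ _)).
  generalize (filter_and (F := F) _ _ Hle Hg). unfold filtermap.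
  apply (filter_imp (F := F)). intros t [H1 H2].
  change (Rabs (g t - 0) < eps) in H2. rewrite Rminus_0_r in H2.
  pose proof (Rle_abs (g t)). apply HP. split.
  - change (Rabs (Re (f t) - 0) < eps). rewrite Rminus_0_r.
    pose proof (Re_le_Cmod (f t)). lra.
  - change (Rabs (Im (f t) - 0) < eps). rewrite Rminus_0_r.
    pose proof (Im_le_Cmod (f t)). lra.
Qed.

Lemma atan_le_id (x : R) : Rabs (atan x) <= Rabs x.
Proof.
  replace (atan x) with (atan x - atan 0) by (rewrite atan_0; ring).
  replace (Rabs x) with (1 * Rabs (x - 0)) by (rewrite Rminus_0_r; ring).
  apply (bounded_variation atan (fun t => / (1 + t²))).
  intros t _. split; [apply is_derive_atan |].
  pose proof (Rle_0_sqr t).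
  rewrite Rabs_pos_eq by (left; apply Rinv_0_lt_compat; lra).
  rewrite <- Rinv_1. apply Rinv_le_contravar; lra.
Qed.

(** The distance from (s, b) to the real point s costs 2|b|/s for the logarithm
    and 4|b|/s for Ein, and on the real axis the difference is at most 1/s. *)
Lemma Cln_minus_Ein_small (s b : R) : 0 < s ->
  Cmod (Cln (s, b) - Ein_minus_gamma (s, b)) <= (6 * Rabs b + 1) / s.
Proof.
  intro Hs.
  destruct (Ein_minus_gamma_real_bounds s Hs) as (e & Ee & He).
  replace (Cln (s, b) - Ein_minus_gamma (s, b))%C with
    ((Cln (s, b) - RtoC (ln s)) + (RtoC (ln s) - RtoC e) + - (Ein_minus_gamma (s, b) - Ein_minus_gamma (RtoC s)))%C
    by (rewrite Ee; ring).
  apply Rle_trans with (1 := Cmod_triangle _ _). rewrite Cmod_opp.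
  pose proof (Ein_minus_gamma_vertical s b Hs) as H3.
  pose proof (Cmod_triangle (Cln (s, b) - RtoC (ln s)) (RtoC (ln s) - RtoC e)) as H4.
  assert (H2 : Cmod (RtoC (ln s) - RtoC e) <= 1 / s).
  { rewrite <- RtoC_minus, Cmod_R.
    assert (H := ln_le_tangent (s + 1) s ltac:(lra) Hs).
    replace ((s + 1 - s) / s) with (1 / s) in H by (field; lra).
    apply Rabs_le. lra. }
  assert (H1 : Cmod (Cln (s, b) - RtoC (ln s)) <= 2 * (Rabs b / s)).
  { apply Rle_trans with (1 := Cmod_le_parts _). unfold Cln. simpl.
    rewrite Ropp_0, Rplus_0_r.
    assert (Hb1 : Rabs (Carg (s, b)) <= Rabs b / s).
    { rewrite Carg_Re_pos by exact Hs. apply Rle_trans with (1 := atan_le_id _).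
      unfold Rdiv. rewrite Rabs_mult, Rabs_inv, (Rabs_pos_eq s) by lra. lra. }
    assert (Hm : s <= Cmod (s, b) <= s + Rabs b).
    { split.
      - apply Rle_trans with (2 := Re_le_Cmod (s, b)). apply Rle_abs.
      - apply Rle_trans with (1 := Cmod_le_parts (s, b)). simpl.
        rewrite (Rabs_pos_eq s) by lra. lra. }
    assert (Hb2 : Rabs (ln (Cmod (s, b)) + - ln s) <= Rabs b / s).
    { assert (L1 : ln s <= ln (Cmod (s, b))) by (apply ln_le; lra).
      assert (L2 := ln_le_tangent (Cmod (s, b)) s ltac:(lra) Hs).
      assert (L3 : (Cmod (s, b) - s) / s <= Rabs b / s).
      { apply Rmult_le_compat_r; [left; now apply Rinv_0_lt_compat | lra]. }
      apply Rabs_le. lra. }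
    unfold Cminus, Cplus, Copp, Re, Im in *. simpl in *. lra. }
  replace ((6 * Rabs b + 1) / s) with (2 * (Rabs b / s) + 1 / s + 4 * Rabs b / s)
    by (field; lra).
  lra.
Qed.

(** * The exponential integral *)

(** Along the ray, Ln - (Ein - gamma) is a primitive of the integrand, and it
    vanishes at the far end by [Cln_minus_Ein_small]. *)
Lemma ExpIntE1_ray_eq (z : C) : slit_plane z -> ExpIntE1_ray z = (Ein_minus_gamma z - Cln z)%C.
Proof.
  intro Hz. set (W := fun u : R => (Cln (z + RtoC u) - Ein_minus_gamma (z + RtoC u))%C).
  unfold ExpIntE1_ray.
  apply (is_RInt_gen_unique (V := C_R_CompleteNormedModule)).
  replace (Ein_minus_gamma z - Cln z)%C with (minus (RtoC 0 : C_R_NormedModule) (W 0)).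
  2: { change (0 - W 0 = Ein_minus_gamma z - Cln z)%C. unfold W. rewrite Cplus_0_r. ring. }
  apply (is_RInt_gen_antiderivative (V := C_R_NormedModule) _ _ _ _ _ W).
  - apply (Filter_prod _ _ _ (fun a => a = 0) (fun b => 0 < b)); [reflexivity | now exists 0 |].
    intros a b -> Hb. simpl.
    apply (is_RInt_derive (V := C_R_CompleteNormedModule) W).
    + intros t Ht. rewrite Rmin_left in Ht by lra.
      apply Cln_minus_Ein_horizontal, slit_plane_plane_plus; [exact Hz | apply Ht].
    + intros t Ht. rewrite Rmin_left in Ht by lra.
      destruct (Cinv_horizontal z t) as [d Hd]; [apply slit_plane_plane_plus; [exact Hz | apply Ht] |].
      apply (ex_derive_continuous (V := C_R_NormedModule)).
      eexists. unfold Cdiv. apply is_Cderive_mult; [| exact Hd].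
      apply (is_derive_ext (V := C_R_NormedModule) (fun u => Cexp (- z + RtoC u * - (1)))).
      { intro u. f_equal. ring. }
      apply Cexp_line.
  - intros P HP. apply (locally_singleton _ _ HP).
  - apply (filterlim_C_0 _ _ W (fun u => (6 * Rabs (Im z) + 1) / (Re z + u))).
    + exists (- Re z). intros u Hu. unfold W.
      replace (z + RtoC u)%C with (Re z + u, Im z)
        by (destruct z; unfold Cplus; simpl; now rewrite Rplus_0_r).
      apply Cln_minus_Ein_small. lra.
    + intros P [eps HP].
      set (c := 6 * Rabs (Im z) + 1) in *.
      assert (Hc : 0 < c) by (pose proof (Rabs_pos (Im z)); unfold c; lra).
      exists (c / eps - Re z). intros u Hu. apply HP.
      pose proof (cond_pos eps) as He.
      assert (Hce : 0 < c / eps) by now apply Rdiv_lt_0_compat.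
      change (Rabs (c / (Re z + u) - 0) < eps).
      rewrite Rminus_0_r, Rabs_pos_eq by (apply Rdiv_le_0_compat; lra).
      apply Rlt_div_l; [lra |].
      replace c with (eps * (c / eps)) by (field; lra).
      apply Rmult_lt_compat_l; lra.
Qed.

Lemma lim_eq {T : Type} (F : (T -> Prop) -> Prop) (FF : ProperFilter F)
  (g : T -> C) (l : C) :
  filterlim g F (locally l) -> lim (T := C_R_CompleteNormedModule) (filtermap g F) = l.
Proof.
  intro Hg. symmetry.
  apply (filterlim_locally_unique (V := C_R_NormedModule) (F := F) g); [exact Hg |].
  intros P [eps HP].
  apply (filter_imp (F := filtermap g F)) with (1 := HP).
  apply (complete_cauchy (T := C_R_CompleteNormedModule)).
  - apply filtermap_proper_filter, FF.
  - intro e. exists l. apply Hg. apply (locally_ball (T := C_R_NormedModule)).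
Qed.

Lemma filterlim_at_right_continuous (f : R -> C) (l : C) :
  is_Cderive f 0 l -> filterlim f (at_right 0) (locally (f 0)).
Proof.
  intro H.
  assert (Hc : continuous (U := C_R_NormedModule) f 0).
  { apply (ex_derive_continuous (V := C_R_NormedModule)). now exists l. }
  apply filterlim_filter_le_1 with (2 := Hc). apply filter_le_within.
Qed.

Lemma Cln_from_above (a : R) : a < 0 ->
  filterlim (fun e => Cln (a, e)) (at_right 0) (locally (Cln (a, 0))).
Proof.
  intro Ha.
  set (g := fun e : R => ((ln (sqrt (a * a + e * e)), PI + atan (e / a)) : C)).
  assert (E : forall e, 0 <= e -> g e = Cln (a, e)).
  { intros e He. unfold g, Cln. rewrite <- Cmod_eq_sqrt, Carg_second_quadrant by assumption.
    reflexivity. }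
  rewrite <- E by lra.
  apply filterlim_ext_loc with g.
  - exists (mkposreal 1 Rlt_0_1). intros e _ He. apply E. lra.
  - assert (Hp : 0 < a * a + 0 * 0) by nra.
    assert (Hq : 0 < sqrt (a * a + 0 * 0)) by now apply sqrt_lt_R0.
    assert (H1 : ex_derive (fun e => Re (g e)) 0) by (simpl; auto_derive; lra).
    assert (H2 : ex_derive (fun e => Im (g e)) 0) by (simpl; auto_derive; lra).
    destruct H1 as [d1 H1], H2 as [d2 H2].
    apply (filterlim_at_right_continuous g (d1, d2)).
    apply is_Cderive_iff. split; assumption.
Qed.

Lemma plus_mult_Ci (a e : R) : ((a, 0) + RtoC e * Ci)%C = (a, e).
Proof. apply injective_projections; simpl; ring. Qed.

(** Off the cut this is [ExpIntE1_ray_eq]; on the cut both terms of the ray formula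
    at z + i e converge as e decreases to 0. *)
Lemma ExpIntE1_plus_Cln (z : C) : z <> 0 -> (ExpIntE1 z + Cln z)%C = Ein_minus_gamma z.
Proof.
  intro Hz. unfold ExpIntE1.
  destruct (Req_EM_T (Im z) 0) as [Hi | Hi].
  - destruct (Rlt_dec (Re z) 0) as [Hr | Hr].
    + rewrite (lim_eq _ _ _ (Ein_minus_gamma z - Cln z)%C); [ring |].
      destruct z as [a b]. simpl in Hi, Hr. subst b.
      apply filterlim_ext_loc with (fun e => Ein_minus_gamma ((a, 0) + RtoC e * Ci) - Cln (a, e))%C.
      * exists (mkposreal 1 Rlt_0_1). intros e _ He.
        rewrite plus_mult_Ci.
        symmetry. apply ExpIntE1_ray_eq. right. simpl. lra.
      * refine (filterlim_comp_2 (F := at_right 0)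
          (G := locally (Ein_minus_gamma (a, 0))) (H := locally (- Cln (a, 0))%C)
          (fun e => Ein_minus_gamma ((a, 0) + RtoC e * Ci)) (fun e => - Cln (a, e))%C Cplus _ _ _).
        -- assert (E0 : ((a, 0) + RtoC 0 * Ci)%C = (a, 0)).
           { apply plus_mult_Ci. }
           assert (Hd := Ein_minus_gamma_line (a, 0) Ci 0). rewrite E0 in Hd.
           apply (fun H => filterlim_at_right_continuous _ _ (Hd H)) in Hz.
           rewrite E0 in Hz. exact Hz.
        -- refine (filterlim_comp _ _ _ (fun e => Cln (a, e)) Copp _ _ _ (Cln_from_above a Hr) _).
           apply (filterlim_opp (V := C_R_NormedModule)).
        -- apply (filterlim_plus (V := C_R_NormedModule)).
    + rewrite ExpIntE1_ray_eq; [ring |]. left.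
      destruct (Rtotal_order (Re z) 0) as [H | [H | H]]; [contradiction | | exact H].
      exfalso. apply Hz. destruct z as [a b]. simpl in *. now subst.
  - rewrite ExpIntE1_ray_eq; [ring | now right].
Qed.

(** * Series along a progression and roots of unity *)

Lemma Csum_n_mult_l (w : C) (a : nat -> C) (N : nat) :
  (w * sum_n (G := C_AbelianMonoid) a N)%C
  = sum_n (G := C_AbelianMonoid) (fun t => w * a t)%C N.
Proof. symmetry. apply (sum_n_mult_l (K := C_Ring) w a N). Qed.

Lemma Csum_n_S (a : nat -> C) (N : nat) :
  sum_n (G := C_AbelianMonoid) a (S N) = (sum_n (G := C_AbelianMonoid) a N + a (S N))%C.
Proof. exact (sum_Sn (G := C_AbelianMonoid) a N). Qed.

Lemma is_Cseries_sum_n (a : nat -> nat -> C) (l : nat -> C) (N : nat) :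
  (forall t, is_Cseries (a t) (l t)) ->
  is_Cseries (fun j => sum_n (G := C_AbelianMonoid) (fun t => a t j) N)
    (sum_n (G := C_AbelianMonoid) l N).
Proof.
  intro H. induction N as [| N IH].
  - rewrite sum_O. apply (is_series_ext (V := C_R_NormedModule) (a 0%nat)); [| apply H].
    intro j. symmetry. apply (sum_O (G := C_AbelianMonoid)).
  - rewrite Csum_n_S.
    apply (is_series_ext (V := C_R_NormedModule)
      (fun j => plus (sum_n (G := C_AbelianMonoid) (fun t => a t j) N : C_R_NormedModule)
        (a (S N) j))).
    + intro j. symmetry. apply Csum_n_S.
    + apply (is_series_plus (V := C_R_NormedModule)); [exact IH | apply H].
Qed.

Lemma Csum_n_m_last (b : nat -> C) (lo hi : nat) : (lo <= hi)%nat ->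
  (forall j, (lo <= j < hi)%nat -> b j = 0) ->
  sum_n_m (G := C_AbelianMonoid) b lo hi = b hi.
Proof.
  intros Hle Hb. destruct (Nat.eq_dec lo hi) as [-> | Hne].
  - apply (sum_n_n (G := C_AbelianMonoid)).
  - destruct hi as [| hi]; [lia |].
    transitivity (sum_n_m (G := C_AbelianMonoid) b lo hi + b (S hi))%C.
    + apply (sum_n_Sm (G := C_AbelianMonoid)). lia.
    + replace (sum_n_m (G := C_AbelianMonoid) b lo hi) with (RtoC 0); [apply Cplus_0_l |].
      transitivity (sum_n_m (G := C_AbelianMonoid) (fun _ => zero) lo hi).
      * symmetry. apply (sum_n_m_const_zero (G := C_AbelianMonoid)).
      * apply (sum_n_m_ext_loc (G := C_AbelianMonoid)). intros j Hj. symmetry. apply Hb. lia.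
Qed.

(** The partial sums of the subseries are partial sums of the whole series, taken
    at the indices n k + a. *)
Lemma is_Cseries_progression (b : nat -> C) (l : C) (n a : nat) : (a < n)%nat ->
  (forall j, (j mod n)%nat <> a -> b j = 0) ->
  is_Cseries b l -> is_Cseries (fun k => b (n * k + a)%nat) l.
Proof.
  intros Ha Hb Hl.
  assert (Hz : forall k j, (n * k + a < j < n * S k + a)%nat -> b j = 0).
  { intros k j Hj. apply Hb. intro E.
    pose proof (Nat.div_mod_eq j n) as D. rewrite E in D.
    assert (k < j / n < S k)%nat by nia. lia. }
  assert (E : forall k, sum_n (G := C_AbelianMonoid) b (n * k + a)
    = sum_n (G := C_AbelianMonoid) (fun k => b (n * k + a)%nat) k).
  { induction k as [| k IH].
    - rewrite sum_O. unfold sum_n. rewrite Nat.mul_0_r.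
      apply Csum_n_m_last; [lia |]. intros j Hj. apply Hb.
      rewrite Nat.mod_small; lia.
    - rewrite Csum_n_S, <- IH. unfold sum_n.
      transitivity (sum_n_m (G := C_AbelianMonoid) b 0 (n * k + a)
        + sum_n_m (G := C_AbelianMonoid) b (S (n * k + a)) (n * S k + a))%C.
      + apply (sum_n_m_Chasles (G := C_AbelianMonoid)); lia.
      + f_equal. apply Csum_n_m_last; [lia |]. intros j Hj. apply (Hz k). lia. }
  apply (filterlim_ext _ _ (F := eventually) (G := locally (l : C_R_NormedModule)) E).
  apply (filterlim_comp _ _ _ (fun k => (n * k + a)%nat) (sum_n b) _ eventually); [| exact Hl].
  intros P [N HN]. exists N. intros k Hk. apply HN. nia.
Qed.

Lemma Cexp_2PI_nat (k : nat) : Cexp (RtoC (2 * PI * INR k) * Ci) = 1.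
Proof.
  unfold Cexp. simpl.
  replace (2 * PI * INR k * 0 - 0 * 1) with 0 by ring.
  replace (2 * PI * INR k * 1 + 0 * 0) with (0 + 2 * INR k * PI) by ring.
  rewrite exp_0, cos_period, sin_period, cos_0, sin_0.
  apply injective_projections; simpl; ring.
Qed.

Lemma Cexp_2PI_frac_eq_1 (N n : nat) : (0 < n)%nat ->
  Cexp (RtoC (2 * PI * INR N / INR n) * Ci) = 1 -> (N mod n = 0)%nat.
Proof.
  intros Hn H. assert (Hn' : 0 < INR n) by now apply lt_0_INR.
  assert (Hc : cos (2 * (PI * INR N / INR n)) = 1).
  { apply (f_equal fst) in H. unfold Cexp in H. simpl in H.
    replace (2 * PI * INR N / INR n * 0 - 0 * 1) with 0 in H by ring.
    rewrite exp_0, Rmult_1_l in H. rewrite <- H. f_equal. field. lra. }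
  rewrite cos_2a_sin in Hc.
  assert (Hs : sin (PI * INR N / INR n) = 0) by nra.
  apply sin_eq_0_0 in Hs. destruct Hs as [k Hk].
  assert (Hk' : INR N = IZR k * INR n).
  { apply Rmult_eq_reg_l with PI; [| apply PI_neq0].
    replace (PI * INR N) with (PI * INR N / INR n * INR n) by (field; lra).
    rewrite Hk. ring. }
  rewrite !INR_IZR_INZ, <- mult_IZR in Hk'. apply eq_IZR in Hk'.
  apply Nat2Z.inj. rewrite Nat2Z.inj_mod, Hk'. apply Z.mod_mul. lia.
Qed.

Lemma Cmult_eq_0_l (w z : C) : w <> 0 -> (w * z)%C = 0 -> z = 0.
Proof.
  intros Hw H. replace z with (/ w * (w * z))%C by (field; exact Hw).
  rewrite H. ring.
Qed.

(** The sum is geometric of ratio zeta = e^(2 pi i N / n), with zeta^n = 1. *)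
Lemma sum_roots_of_unity (n N : nat) : (1 <= n)%nat ->
  sum_n (G := C_AbelianMonoid)
    (fun t => Cexp (RtoC (2 * PI * INR t * INR N / INR n) * Ci)) (n - 1)
  = if Nat.eq_dec (N mod n) 0 then RtoC (INR n) else RtoC 0.
Proof.
  intro Hn. assert (Hn' : 0 < INR n) by (apply lt_0_INR; lia).
  set (zeta := Cexp (RtoC (2 * PI * INR N / INR n) * Ci)).
  assert (Et : forall t, Cexp (RtoC (2 * PI * INR t * INR N / INR n) * Ci) = (zeta ^ t)%C).
  { intro t. unfold zeta. rewrite Cexp_pow. f_equal.
    rewrite Cmult_assoc, <- RtoC_mult. do 2 f_equal. field. lra. }
  rewrite (sum_n_ext _ _ _ Et).
  assert (Ez : (zeta ^ n)%C = 1).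
  { unfold zeta. rewrite Cexp_pow, Cmult_assoc, <- RtoC_mult, <- (Cexp_2PI_nat N).
    do 3 f_equal. field. lra. }
  assert (Eg : forall p, ((zeta - 1) * sum_n (G := C_AbelianMonoid) (fun t => zeta ^ t)%C p
    = zeta ^ S p - 1)%C).
  { induction p as [| p IH].
    - rewrite sum_O. simpl. ring.
    - rewrite Csum_n_S, Cmult_plus_distr_l, IH, (Cpow_S _ (S p)). ring. }
  destruct (Nat.eq_dec (N mod n) 0) as [Hd | Hd].
  - assert (Hz1 : zeta = 1).
    { unfold zeta. pose proof (Nat.div_mod_eq N n) as D. rewrite Hd, Nat.add_0_r in D.
      rewrite <- (Cexp_2PI_nat (N / n)). do 3 f_equal.
      rewrite D at 1. rewrite mult_INR. field. lra. }
    rewrite (sum_n_ext _ (fun _ => RtoC 1)).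
    2: { intro t. rewrite Hz1. apply Cpow_1_l. }
    assert (Ec : forall p, sum_n (G := C_AbelianMonoid) (fun _ => RtoC 1) p = RtoC (INR (S p))).
    { induction p as [| p IH]; [apply (sum_O (G := C_AbelianMonoid)) |].
      rewrite Csum_n_S, IH, (S_INR (S p)), RtoC_plus. reflexivity. }
    rewrite Ec. do 2 f_equal. lia.
  - assert (Hz1 : (zeta - 1)%C <> 0).
    { intro E. apply Hd. apply Cexp_2PI_frac_eq_1; [lia |]. fold zeta.
      replace zeta with (zeta - 1 + 1)%C by ring. rewrite E. ring. }
    specialize (Eg (n - 1)%nat). replace (S (n - 1)) with n in Eg by lia.
    rewrite Ez in Eg.
    apply (Cmult_eq_0_l _ _ Hz1).
    transitivity (1 - 1)%C; [exact Eg | ring].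
Qed.

Lemma Cexp_Cln_real (x : R) : x <> 0 -> Cexp (Cln (RtoC x)) = RtoC x.
Proof.
  intro Hx. unfold Cln. rewrite Cmod_R.
  assert (Hp : 0 < Rabs x) by now apply Rabs_pos_lt.
  unfold Cexp. simpl. rewrite exp_ln by exact Hp.
  destruct (Rdichotomy _ _ Hx) as [H | H].
  - unfold RtoC. rewrite Carg_second_quadrant by lra.
    unfold Rdiv. rewrite Rmult_0_l, atan_0, Rplus_0_r, cos_PI, sin_PI, Rabs_left by exact H.
    f_equal; ring.
  - unfold RtoC. rewrite Carg_Re_pos by exact H.
    unfold Rdiv. rewrite Rmult_0_l, atan_0, cos_0, sin_0, Rabs_pos_eq by lra.
    f_equal; ring.
Qed.

Lemma Croot_pow (n : nat) (x : R) : (1 <= n)%nat -> x <> 0 ->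
  (Croot n (RtoC x) ^ n)%C = RtoC x.
Proof.
  intros Hn Hx. unfold Croot. rewrite Cexp_pow.
  transitivity (Cexp (Cln (RtoC x))); [| now apply Cexp_Cln_real].
  f_equal. field. intro E. apply RtoC_inj in E.
  assert (0 < INR n) by (apply lt_0_INR; lia). lra.
Qed.

(** * The derivative of the integral Mittag-Leffler function *)

Lemma is_derive_affine (a b s : R) : is_derive (fun u => u * a + b) s a.
Proof. auto_derive; [exact I | ring]. Qed.

(** The constant 4 |x| + 1 keeps the ratio below 1/4, which leaves room for the
    factor k <= 2^(k-1) in the Lipschitz bounds. *)
Lemma pow_ratio_le (x c : R) (j : nat) : 0 < c ->
  Rabs x ^ S j * (c / (4 * Rabs x + 1) ^ S j) <= c * (1 / 4) ^ j.
Proof.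
  intro Hc. set (q := 4 * Rabs x + 1). pose proof (Rabs_pos x) as Hx.
  assert (Hq : 1 <= q) by (unfold q; lra).
  assert (Hqk : 0 < q ^ S j) by (apply pow_lt; lra).
  assert (H : Rabs x ^ S j <= (1 / 4 * q) ^ S j) by (apply pow_incr; unfold q; lra).
  rewrite Rpow_mult_distr in H.
  assert (H4 : 0 < (1 / 4) ^ j) by (apply pow_lt; lra).
  assert (H5 : (1 / 4) ^ S j <= (1 / 4) ^ j) by (simpl; lra).
  apply Rle_trans with ((1 / 4) ^ S j * q ^ S j * (c / q ^ S j)).
  - apply Rmult_le_compat_r; [apply Rdiv_le_0_compat; lra | exact H].
  - replace ((1 / 4) ^ S j * q ^ S j * (c / q ^ S j)) with (c * (1 / 4) ^ S j) by (field; lra).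
    apply Rmult_le_compat_l; lra.
Qed.

(** Since n k - m >= k when m < n, a change of alpha by less than 1/2 keeps the
    k-th argument at least k/2, where 1/Gamma is smooth, given by the Gamma
    integral, and of super-geometric decay.  The value D is left abstract
    because its series is summed later by means of roots of unity. *)
Lemma is_derive_EiML (n m : nat) (x : R) (D : C) : (m < n)%nat ->
  is_Cseries (fun k => RtoC (- (x ^ S k *
    (psi_coef (n * k + (n - 1 - m)) / INR (fact (n * k + (n - 1 - m))))))) D ->
  is_Cderive (fun alpha => RtoC (EiML alpha (- INR m) x)) (INR n) D.
Proof.
  intros Hm HD.
  destruct (rGamma_decay (4 * Rabs x + 1)) as (c & Hc & Hdecay).
  { pose proof (Rabs_pos x). lra. }
  pose proof (pos_INR m) as Hm0.
  assert (Hmn : INR m + 1 <= INR n) by (rewrite <- S_INR; now apply le_INR).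
  assert (Hcenter : forall k, INR n * INR (S k) + - INR m = INR (S (n * k + (n - 1 - m)))).
  { intro k. rewrite !S_INR, plus_INR, mult_INR, !minus_INR by lia. simpl. ring. }
  assert (Hlow : forall k, INR (S k) <= INR n * INR (S k) + - INR m).
  { intro k. rewrite S_INR. pose proof (pos_INR k). nra. }
  assert (Hdist : forall k y, Rabs (y - INR n) < 1 / 2 ->
    Rabs ((y * INR (S k) + - INR m) - (INR n * INR (S k) + - INR m))
      = INR (S k) * Rabs (y - INR n) /\
    INR (S k) * Rabs (y - INR n) <= INR (S k) / 2).
  { intros k y Hy. pose proof (pos_INR (S k)). split; [| nra].
    replace (y * INR (S k) + - INR m - (INR n * INR (S k) + - INR m))
      with (INR (S k) * (y - INR n)) by ring.
    rewrite Rabs_mult, (Rabs_pos_eq (INR (S k))); lra. }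
  assert (Hterm : forall k y, Rabs (x ^ S k / INR (S k) * y)
    = Rabs x ^ S k * / INR (S k) * Rabs y).
  { intros k y. assert (0 < INR (S k)) by (apply lt_0_INR; lia).
    unfold Rdiv. rewrite !Rabs_mult, Rabs_inv, (Rabs_pos_eq (INR (S k))) by lra.
    now rewrite RPow_abs. }
  assert (Hhalf : 0 < 1 / 2) by lra.
  apply (is_derive_series (V := C_R_NormedModule)
    (fun k alpha => RtoC (x ^ S k / INR (S k) * rGamma (alpha * INR (S k) + - INR m)))
    (fun k => RtoC (- (x ^ S k *
      (psi_coef (n * k + (n - 1 - m)) / INR (fact (n * k + (n - 1 - m)))))))
    _ _ (fun k => (INR n + 4) * c * (1 / 2) ^ k) (INR n) (mkposreal _ Hhalf)).
  - intro k. apply is_Cderive_RtoC.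
    assert (HS : 0 < INR (S k)) by (apply lt_0_INR; lia).
    evar_last.
    + apply is_derive_scal.
      apply (is_derive_comp (V := R_NormedModule) rGamma
        (fun alpha => alpha * INR (S k) + - INR m)).
      * rewrite Hcenter. apply is_derive_rGamma, lt_0_INR. lia.
      * apply is_derive_affine.
    + rewrite rGamma_pos by (apply lt_0_INR; lia).
      unfold lnGamma. rewrite exp_Ropp, exp_ln, GammaInt_fact
        by (apply GammaInt_pos, lt_0_INR; lia).
      unfold psi_coef. set (N := (n * k + (n - 1 - m))%nat).
      match goal with |- @eq _ (_ * (scal ?b ?d)) ?r =>
        change (x ^ S k / INR (S k) * (b * d) = r) end.
      pose proof (INR_fact_pos N). field. lra.
  - intros k y Hy. simpl in Hy.
    match goal with |- norm (minus (RtoC ?a) (RtoC ?b)) <= _ =>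
      change (norm (V := C_R_NormedModule) (RtoC a - RtoC b)%C <=
        (INR n + 4) * c * (1 / 2) ^ k * Rabs (y - INR n)) end.
    rewrite <- Cmod_norm, <- RtoC_minus, Cmod_R, <- Rmult_minus_distr_l, Hterm.
    destruct (Hdist k y Hy) as [E Hd].
    assert (HS : 1 <= INR (S k)) by (apply (le_INR 1); lia).
    assert (Hl := rGamma_lipschitz (S k) (c / (4 * Rabs x + 1) ^ S k) _
      (y * INR (S k) + - INR m) ltac:(lia) (Hlow k)).
    rewrite E in Hl.
    specialize (Hl Hd (fun y => Hdecay (S k) y ltac:(lia))).
    set (Q := c / (4 * Rabs x + 1) ^ S k) in *.
    assert (HQ : Rabs x ^ S k * Q <= c * (1 / 4) ^ k) by now apply pow_ratio_le.
    assert (HQ0 : 0 < Q) by (pose proof (Hdecay (S k) (INR (S k)) ltac:(lia) ltac:(lra)); unfold Q; lra).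
    assert (Hxk : 0 <= Rabs x ^ S k) by (apply pow_le, Rabs_pos).
    set (h := Rabs (y - INR n)) in *. assert (Hh : 0 <= h) by apply Rabs_pos.
    set (K := INR (S k)) in *.
    assert (HK : K <= 2 ^ k) by apply INR_le_pow2.
    apply Rle_trans with (Rabs x ^ S k * / K * (((INR n + 4) * K) * Q * (K * h))).
    + apply Rmult_le_compat_l.
      { apply Rmult_le_pos; [exact Hxk | left; apply Rinv_0_lt_compat; lra]. }
      apply Rle_trans with (1 := Hl).
      apply Rmult_le_compat_r; [apply Rmult_le_pos; lra |].
      apply Rmult_le_compat_r; [lra |]. nra.
    + replace (Rabs x ^ S k * / K * ((INR n + 4) * K * Q * (K * h)))
        with (Rabs x ^ S k * Q * K * ((INR n + 4) * h)) by (field; lra).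
      replace ((INR n + 4) * c * (1 / 2) ^ k * h)
        with (c * (1 / 4) ^ k * 2 ^ k * ((INR n + 4) * h)).
      * apply Rmult_le_compat_r; [apply Rmult_le_pos; lra |].
        apply Rmult_le_compat; [apply Rmult_le_pos; lra | lra | exact HQ | exact HK].
      * replace (1 / 2) with (1 / 4 * 2) by field. rewrite Rpow_mult_distr. ring.
  - apply (ex_series_scal_l (V := R_NormedModule)). apply ex_series_geom.
    rewrite Rabs_pos_eq; lra.
  - intros y Hy. simpl in Hy. apply is_Cseries_RtoC. apply Series_correct.
    apply (ex_series_le (V := R_CompleteNormedModule) _ (fun k => c * (1 / 4) ^ k)).
    + intro k. match goal with |- norm ?a <= _ => change (Rabs a <= c * (1 / 4) ^ k) end.
      rewrite Hterm. destruct (Hdist k y Hy) as [E Hd].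
      assert (HS : 1 <= INR (S k)) by (apply (le_INR 1); lia).
      assert (Hr : INR (S k) / 2 <= y * INR (S k) + - INR m).
      { specialize (Hlow k). rewrite <- E in Hd. apply Rabs_le_between in Hd. lra. }
      destruct (Hdecay (S k) _ ltac:(lia) Hr) as [H1 H2].
      apply Rle_trans with (2 := pow_ratio_le x c k Hc).
      rewrite (Rabs_pos_eq (rGamma _)) by lra. rewrite Rmult_assoc.
      apply Rmult_le_compat_l; [apply pow_le, Rabs_pos |].
      apply Rle_trans with (2 := H2).
      rewrite <- (Rmult_1_l (rGamma _)) at 2. apply Rmult_le_compat_r; [lra |].
      rewrite <- Rinv_1. apply Rinv_le_contravar; lra.
    + apply (ex_series_scal_l (V := R_NormedModule)). apply ex_series_geom.
      rewrite Rabs_pos_eq; lra.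
  - exact HD.
Qed.

Lemma Cexp_mult_E1_plus_ln (z : C) : z <> 0 ->
  (Cexp z * (ExpIntE1 z + Cln z))%C = egf psi_coef z.
Proof.
  intro Hz. rewrite ExpIntE1_plus_Cln by exact Hz. unfold Ein_minus_gamma.
  rewrite Cmult_assoc, (Cmult_comm (Cexp z)), Cexp_opp_mult. ring.
Qed.

(** The combination of roots of unity on the right of the theorem, applied to a
    single term of the generating series. *)
Lemma egf_term_root_filter (n m j : nat) (c : nat -> R) (r : C) : (1 <= n)%nat ->
  (- (Cpow r (m + 1) / RtoC (INR n)) * sum_n (G := C_AbelianMonoid) (fun t : nat =>
     Cexp (RtoC (2 * PI * INR t * INR (m + 1) / INR n) * Ci) *
     egf_term c (Cexp (RtoC (2 * PI * INR t / INR n) * Ci) * r) j)%C (n - 1))%C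
  = if Nat.eq_dec ((j + m + 1) mod n) 0
    then (RtoC (- (c j / INR (fact j))) * r ^ (j + m + 1))%C else RtoC 0.
Proof.
  intro Hn. assert (Hn' : 0 < INR n) by (apply lt_0_INR; lia).
  assert (Hn0 : RtoC (INR n) <> 0) by (intro E; apply RtoC_inj in E; lra).
  rewrite (sum_n_ext _ (fun t => RtoC (c j / INR (fact j)) * r ^ j *
    Cexp (RtoC (2 * PI * INR t * INR (j + m + 1) / INR n) * Ci))%C).
  2: { intro t. unfold egf_term. rewrite Cpow_mult_l, Cexp_pow.
       replace (RtoC (2 * PI * INR t * INR (j + m + 1) / INR n) * Ci)%C
         with (RtoC (2 * PI * INR t * INR (m + 1) / INR n) * Ci +
           RtoC (INR j) * (RtoC (2 * PI * INR t / INR n) * Ci))%C.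
       - rewrite Cexp_plus.
         match goal with |- @eq _ ?a ?b => change (a = b :> C) end. ring.
       - rewrite Cmult_assoc, <- RtoC_mult, <- Cmult_plus_distr_r, <- RtoC_plus.
         do 2 f_equal. rewrite <- Nat.add_assoc, (plus_INR j). field. lra. }
  rewrite <- Csum_n_mult_l, sum_roots_of_unity by exact Hn.
  destruct (Nat.eq_dec ((j + m + 1) mod n) 0) as [_ | _]; [| ring].
  rewrite <- Nat.add_assoc, (Cpow_add_r r j (m + 1)), RtoC_opp. field. exact Hn0.
Qed.

Theorem theorem2p1 :
  forall (n m : nat) (x : R), (1 <= n)%nat -> (m < n)%nat -> x <> 0 ->
  let xi : nat -> C := fun t : nat =>
    (Cexp (RtoC (2 * PI * INR t / INR n) * Ci) * Croot n (RtoC x))%C in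
  is_derive (K := R_AbsRing) (V := C_R_NormedModule)
    (fun alpha : R => RtoC (EiML alpha (- INR m) x)) (INR n)
    (- (Cpow (Croot n (RtoC x)) (m + 1) / RtoC (INR n))
       * sum_n (G := C_AbelianMonoid) (fun t : nat =>
           (Cexp (RtoC (2 * PI * INR t * INR (m + 1) / INR n) * Ci)
             * Cexp (xi t) * (ExpIntE1 (xi t) + Cln (xi t)))%C)
         (n - 1))%C.
Proof.
  intros n m x Hn Hm Hx xi. apply is_derive_EiML; [exact Hm |].
  set (r := Croot n (RtoC x)) in *.
  assert (Hxi : forall t, xi t <> 0).
  { intros t H. revert H. unfold xi. apply Cmult_neq_0; apply Cexp_neq_0. }
  set (E := fun t => Cexp (RtoC (2 * PI * INR t * INR (m + 1) / INR n) * Ci)).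
  rewrite (sum_n_ext _ (fun t => E t * egf psi_coef (xi t))%C).
  2: { intro t. unfold E. rewrite <- Cexp_mult_E1_plus_ln by apply Hxi.
       symmetry. apply Cmult_assoc. }
  set (b := fun j => if Nat.eq_dec ((j + m + 1) mod n) 0
    then (RtoC (- (psi_coef j / INR (fact j))) * r ^ (j + m + 1))%C else RtoC 0).
  apply (is_series_ext (V := C_R_NormedModule) (fun k => b (n * k + (n - 1 - m))%nat)).
  - intro k. unfold b.
    replace (n * k + (n - 1 - m) + m + 1)%nat with (n * S k)%nat by lia.
    rewrite Nat.mul_comm, Nat.Div0.mod_mul. simpl (Nat.eq_dec 0 0).
    rewrite (Nat.mul_comm (S k)), Cpow_mult_r. unfold r. rewrite Croot_pow by assumption.
    rewrite <- RtoC_pow, <- RtoC_mult. f_equal. rewrite (Nat.mul_comm n k). ring.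
  - apply is_Cseries_progression; [lia | |].
    + intros j Hj. unfold b. destruct (Nat.eq_dec ((j + m + 1) mod n) 0) as [H | _]; [| reflexivity].
      exfalso. apply Hj.
      assert (D := Nat.div_mod_eq (j + m + 1) n). rewrite H in D.
      set (d := ((j + m + 1) / n)%nat) in *.
      assert (Hd : (1 <= d)%nat) by (destruct d; lia).
      (* j + m + 1 = n d, hence j = n (d - 1) + (n - 1 - m). *)
      symmetry. apply (Nat.mod_unique j n (d - 1)); [lia |]. nia.
    + apply (is_series_ext (V := C_R_NormedModule) (fun j =>
        - (Cpow r (m + 1) / RtoC (INR n)) * sum_n (G := C_AbelianMonoid)
          (fun t => E t * egf_term psi_coef (xi t) j)%C (n - 1))%C).
      * intro j. now apply egf_term_root_filter.
      * apply is_Cseries_mult_l.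
        apply (is_Cseries_sum_n (fun t j => E t * egf_term psi_coef (xi t) j)%C).
        intro t. apply is_Cseries_mult_l, is_Cseries_egf, geom_bounded_psi_coef.
Qed.
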